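(* Let $G$ be a profinite group equipped with an expansive endomorphism $\sigma\colon G\to G$. Then there exists a subnormal series $$G\supseteq G_1\supseteq G_2\supseteq\ldots\supseteq G_n$$ of closed $\sigma$-stable subgroups $G_i$ of $G$ such that (1) $G_i/G_{i+1}$ is isomorphic to a full one-sided group shift on a finite simple group $\mathcal{G}_i$ for $i=1,\ldots,n-1$; (2) $G/G_1$ is a finite group and the induced map $\sigma\colon G/G_1\to G/G_1$ is an automorphism; (3) $G_n$ is a finite group and some power of $\sigma\colon G_n\to G_n$ is the trivial endomorphism $g\mapsto 1$. Moreover, the length $n$ of such a series, the group $G_1$ and the isomorphism classes of the finite simple groups $\mathcal{G}_i$ are uniquely determined by $G$. That is, if $G\supseteq H_1\supseteq\ldots\supseteq H_m$ is another such series with corresponding finite simple groups $\mathcal{H}_1,\ldots,\mathcal{H}_{m-1}$, then $m=n$, $H_1=G_1$ and there exists a permutation $\pi$ of $\{1,\ldots,n-1\}$ such that $\mathcal{G}_i\simeq\mathcal{H}_{\pi(i)}$ for $i=1,\ldots,n-1$.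
   Context: $\mathbb{N}$ contains $0$. An endomorphism of a profinite group is a continuous group homomorphism to itself. An endomorphism $\sigma\colon G\to G$ of a profinite group $G$ is expansive if there exists an open subgroup $U$ of $G$ with $\bigcap_{n\in\mathbb{N}}\sigma^{-n}(U)=1$. A subset $Y\subseteq G$ is $\sigma$-stable if $\sigma(Y)\subseteq Y$. A subnormal series here means that $G_1$ is normal in $G$ and $G_{i+1}$ is normal in $G_i$ for $i=1,\ldots,n-1$; here $n\geq 1$. Quotients by closed normal $\sigma$-stable subgroups carry the quotient topology and the induced endomorphism, again denoted $\sigma$. For a finite group $\mathcal{G}$, the full one-sided group shift on $\mathcal{G}$ is the profinite group $\mathcal{G}^{\mathbb{N}}$ (product topology, componentwise multiplication) with the endomorphism $\sigma(g_0,g_1,\ldots)=(g_1,g_2,\ldots)$. Isomorphisms of profinite groups with endomorphism are isomorphisms of topological groups commuting with $\sigma$. *)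

(* Defs.v *)
From HB Require Import structures.
From mathcomp Require Import all_boot fingroup morphism perm gseries.
From mathcomp Require Import all_classical.
From mathcomp Require Import topology generic_quotient.

Set Implicit Arguments.
Unset Strict Implicit.
Unset Printing Implicit Defensive.

Local Open Scope classical_set_scope.
Local Open Scope quotient_scope.
Local Open Scope group_scope.

HB.mixin Record isTopologicalGroup G & monoid.Group G & Topological G := {
  mulg_continuous : continuous (fun x : G * G => x.1 * x.2) ;
  invg_continuous : continuous (fun x : G => x^-1) ;
}.

#[short(type="topGroupType")]
HB.structure Definition TopologicalGroup :=
  {G of monoid.Group G & Topological G & isTopologicalGroup G}.

Definition profinite (G : topGroupType) : Prop :=
  [/\ compact [set: G], hausdorff_space G & totally_disconnected [set: G]].

Definition endomorphism (G : topGroupType) (sigma : G -> G) : Prop :=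
  {morph sigma : x y / x * y} /\ continuous sigma.

Definition topgroup_isomorphism (K L : topGroupType) (f : K -> L) : Prop :=
  [/\ {morph f : x y / x * y}, continuous f
    & exists g : L -> K, [/\ cancel f g, cancel g f & continuous g]].

Definition isomorphic_with_endo (K L : topGroupType)
    (s : K -> K) (t : L -> L) : Prop :=
  exists f : K -> L,
    topgroup_isomorphism f /\ (forall x, f (s x) = t (f x)).

Record subgroup (G : groupType) := Subgroup {
  subgroup_set :> set G ;
  subgroup_closed : group_closed (mem subgroup_set)
}.

Definition expansive (G : topGroupType) (sigma : G -> G) : Prop :=
  exists U : subgroup G,
    open (U : set G) /\ \bigcap_n (iter n sigma @^-1` U) = [set 1].

Section SubgroupType.
Variables (G : topGroupType) (H : subgroup G).

HB.instance Definition _ := SubChoice.on (set_type H).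
HB.instance Definition _ :=
  SubChoice_isSubGroup.Build G _ (set_type H) (subgroup_closed H).

Lemma subgroup_mul_continuous :
  continuous (fun x : set_type H * set_type H => x.1 * x.2).
Proof.
apply: continuous_comp_initial => -[x y] /=.
have -> : set_val \o (fun z : set_type H * set_type H => z.1 * z.2) =
          (fun z : G * G => z.1 * z.2) \o
          (fun z : set_type H * set_type H => (set_val z.1, set_val z.2)).
  by apply/funext.
apply: continuous_comp; last exact: mulg_continuous.
have vc : continuous (set_val : set_type H -> G) by exact: initial_continuous.
have c1 : continuous (fun z : set_type H * set_type H => set_val z.1).
  move=> z.
  apply: (@continuous_comp _ (set_type H) G fst set_val); last exact: vc.
  exact: cvg_fst.
have c2 : continuous (fun z : set_type H * set_type H => set_val z.2).
  move=> z.
  apply: (@continuous_comp _ (set_type H) G snd set_val); last exact: vc.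
  exact: cvg_snd.
exact: (cvg_pair (c1 (x, y)) (c2 (x, y))).
Qed.

Lemma subgroup_inv_continuous : continuous (fun x : set_type H => x^-1).
Proof.
apply: continuous_comp_initial => x /=.
apply: (@continuous_comp _ _ _ (set_val : set_type H -> G) (fun y => y^-1)).
  exact: initial_continuous.
exact: invg_continuous.
Qed.

HB.instance Definition _ := isTopologicalGroup.Build (set_type H)
  subgroup_mul_continuous subgroup_inv_continuous.

End SubgroupType.

Section QuotientType.
Variables (K : topGroupType).

Record normal_subgroup := NormalSubgroup {
  normal_subgroup_val :> subgroup K ;
  normal_subgroup_conjg :
    forall x y, x \in (normal_subgroup_val : set K) ->
      x ^ y \in (normal_subgroup_val : set K)
}.

Variable N : normal_subgroup.

Let Nset : {pred K} := mem (N : set K).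

Let N1 : 1 \in Nset. Proof. by case: (subgroup_closed N). Qed.
Let NM x y : x \in Nset -> y \in Nset -> x * y \in Nset.
Proof. exact/group_closedM/(subgroup_closed N). Qed.
Let NV x : x \in Nset -> x^-1 \in Nset.
Proof. exact/group_closedV/(subgroup_closed N). Qed.
Let NJ x y : x \in Nset -> x ^ y \in Nset.
Proof. exact: normal_subgroup_conjg. Qed.

Definition coset_rel : rel K := fun x y => x^-1 * y \in (N : set K).

Lemma coset_rel_refl : reflexive coset_rel.
Proof. by move=> x; rewrite /coset_rel mulVg. Qed.

Lemma coset_rel_sym : symmetric coset_rel.
Proof.
have half x y : coset_rel x y -> coset_rel y x.
  by move/NV; rewrite invgM invgK.
by move=> x y; apply/idP/idP; exact: half.
Qed.

Lemma coset_rel_trans : transitive coset_rel.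
Proof.
move=> y x z /NM Nxy /Nxy.
by rewrite -mulgA (mulgA y) mulgV mul1g.
Qed.

Canonical coset_equiv :=
  EquivRel coset_rel coset_rel_refl coset_rel_sym coset_rel_trans.

Definition quotient_group : Type := quotient_topology {eq_quot coset_equiv}.

HB.instance Definition _ := Topological.on quotient_group.
HB.instance Definition _ := Quotient.on quotient_group.

Lemma coset_piP (x y : K) :
  reflect (\pi_quotient_group x = \pi_quotient_group y)
          (x^-1 * y \in (N : set K)).
Proof. exact: (@eqquotP _ coset_equiv). Qed.

Definition quotient_one : quotient_group := \pi_quotient_group 1.
Definition quotient_mul (a b : quotient_group) : quotient_group :=
  \pi_quotient_group (repr a * repr b).
Definition quotient_inv (a : quotient_group) : quotient_group :=
  \pi_quotient_group (repr a)^-1.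

Lemma coset_repr (x : K) :
  exists2 n, n \in Nset & repr (\pi_quotient_group x) = x * n.
Proof.
exists (x^-1 * repr (\pi_quotient_group x)); last by rewrite mulgA mulgV mul1g.
by apply/coset_piP; rewrite reprK.
Qed.

Lemma quotient_mulE (x y : K) :
  quotient_mul (\pi_quotient_group x) (\pi_quotient_group y) = \pi_quotient_group (x * y).
Proof.
apply/esym/coset_piP.
have [m Nm ->] := coset_repr x; have [n Nn ->] := coset_repr y.
have -> : (x * y)^-1 * (x * m * (y * n)) = m ^ y * n.
  by rewrite invgM !mulgA mulgKV -!mulgA.
by apply: NM => //; exact: NJ.
Qed.

Lemma quotient_invE (x : K) :
  quotient_inv (\pi_quotient_group x) = \pi_quotient_group x^-1.
Proof.
apply/esym/coset_piP; have [n Nn ->] := coset_repr x.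
have -> : x^-1^-1 * (x * n)^-1 = n^-1 ^ x^-1.
  by rewrite invgM /conjg.
exact/NJ/NV.
Qed.

Lemma quotient_mulA : associative quotient_mul.
Proof.
move=> a b c; rewrite -[a]reprK -[b]reprK -[c]reprK.
move: (repr a) (repr b) (repr c) => x y z.
rewrite (quotient_mulE y z) (quotient_mulE x y) (quotient_mulE x (y * z)).
by rewrite (quotient_mulE (x * y) z) mulgA.
Qed.

Lemma quotient_mul1 : left_id quotient_one quotient_mul.
Proof. by move=> a; rewrite -[a]reprK quotient_mulE mul1g. Qed.

Lemma quotient_1mul : right_id quotient_one quotient_mul.
Proof. by move=> a; rewrite -[a]reprK quotient_mulE mulg1. Qed.

Lemma quotient_mulV : left_inverse quotient_one quotient_inv quotient_mul.
Proof. by move=> a; rewrite -[a]reprK quotient_invE quotient_mulE mulVg. Qed.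

Lemma quotient_Vmul : right_inverse quotient_one quotient_inv quotient_mul.
Proof. by move=> a; rewrite -[a]reprK quotient_invE quotient_mulE mulgV. Qed.

HB.instance Definition _ := isGroup.Build quotient_group
  quotient_mulA quotient_mul1 quotient_1mul quotient_mulV quotient_Vmul.

Lemma quotient_piM : {morph \pi_quotient_group : x y / x * y}.
Proof. by move=> x y; exact/esym/quotient_mulE. Qed.

Lemma quotient_pi_continuous : continuous \pi_quotient_group.
Proof. exact: (@pi_continuous K {eq_quot coset_equiv}). Qed.

Lemma quotient_pi_open (A : set K) :
  open A -> open (\pi_quotient_group @` A).
Proof.
move=> oA; rewrite /open /= /quotient_open.
have -> : \pi_quotient_group @^-1` (\pi_quotient_group @` A) =
    \bigcup_(n in (N : set K)) ((fun x => x * n) @^-1` A).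
  apply/seteqP; split=> [x /= [a Aa /esym/coset_piP Nxa]|x [n Nn /= Axn]].
    exists (x^-1 * a); first by move: Nxa; rewrite inE.
    by rewrite /= mulgA mulgV mul1g.
  exists (x * n) => //; apply/esym/coset_piP.
  by rewrite mulgA mulVg mul1g inE.
apply: bigcup_open => n _; apply: open_comp => // x _.
apply: (@continuous_comp _ _ _ (fun x => (x, n)) (fun z : K * K => z.1 * z.2)).
  by apply: cvg_pair; [exact: cvg_id|exact: cvg_cst].
exact: mulg_continuous.
Qed.

Lemma quotient_pi_nbhs (x : K) (A : set K) :
  nbhs x A -> nbhs (\pi_quotient_group x) (\pi_quotient_group @` A).
Proof.
rewrite nbhsE => -[B [oB Bx] BA].
apply: (@filterS _ _ _ (\pi_quotient_group @` B)); first exact: image_subset.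
by apply: open_nbhs_nbhs; split; [exact: quotient_pi_open|exists x].
Qed.

Lemma quotient_mul_continuous :
  continuous (fun x : quotient_group * quotient_group => x.1 * x.2).
Proof.
move=> [a b]; rewrite -[a]reprK -[b]reprK.
move: (repr a) (repr b) => x y U /=.
rewrite -quotient_piM => /quotient_pi_continuous/(@mulg_continuous K (x, y)).
case=> -[A B] [/= xA yB] AB.
exists (\pi_quotient_group @` A, \pi_quotient_group @` B) => /=.
  by split; exact: quotient_pi_nbhs.
move=> [_ _] [/= [u Au <-] [v Bv <-]] /=.
by rewrite -quotient_piM; exact: (AB (u, v)).
Qed.

Lemma quotient_inv_continuous : continuous (fun x : quotient_group => x^-1).
Proof.
move=> a; rewrite -[a]reprK; move: (repr a) => x U /=.
rewrite [_^-1]quotient_invE => /quotient_pi_continuous/(@invg_continuous K x).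
move=> /quotient_pi_nbhs; apply: filterS => _ [y Uy <-] /=.
by rewrite [_^-1]quotient_invE.
Qed.

HB.instance Definition _ := isTopologicalGroup.Build quotient_group
  quotient_mul_continuous quotient_inv_continuous.

(* The value at xN is sigma(r)N for the chosen representative r of xN; it is
   sigma(x)N whenever N is sigma-stable. *)
Definition quotient_endo (sigma : K -> K) (a : quotient_group) :
  quotient_group := \pi_quotient_group (sigma (repr a)).

Lemma quotient_endoE (sigma : K -> K) (x : K) :
  {morph sigma : x y / x * y} ->
  (forall y, (N : set K) y -> (N : set K) (sigma y)) ->
  quotient_endo sigma (\pi_quotient_group x) = \pi_quotient_group (sigma x).
Proof.
move=> sM sN; apply/esym/coset_piP; have [n Nn ->] := coset_repr x.
by rewrite sM mulgA mulVg mul1g inE; apply: sN; rewrite -inE.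
Qed.

End QuotientType.

Section Relative.
Variables (G : topGroupType) (H L : subgroup G).

Definition normalised_by : Prop :=
  forall x y, x \in (L : set G) -> y \in (H : set G) -> x ^ y \in (L : set G).

Lemma relative_subgroup_closed :
  group_closed (mem ((set_val : set_type H -> G) @^-1` L)).
Proof.
have [L1 LF] := subgroup_closed L.
split=> [|x y /set_mem Lx /set_mem Ly]; apply/mem_set; first exact: set_mem L1.
by apply/set_mem/(LF (val x) (val y)); exact: mem_set.
Qed.

(* This is L `&` H as a subgroup of the group H. *)
Definition relative_subgroup : subgroup (set_type H) :=
  Subgroup relative_subgroup_closed.

Lemma relative_conjg (nLH : normalised_by) (x y : set_type H) :
  x \in (relative_subgroup : set _) -> x ^ y \in (relative_subgroup : set _).
Proof.
move=> /set_mem /= /mem_set Lx; apply/mem_set => /=; apply: set_mem.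
exact: (nLH (val x) (val y) Lx (valP y)).
Qed.

Definition relative_normal_subgroup (nLH : normalised_by) :
  normal_subgroup (set_type H) := NormalSubgroup (relative_conjg nLH).

End Relative.

Section Restriction.
Variables (G : topGroupType) (sigma : G -> G).

Record stable_subgroup := StableSubgroup {
  stable_subgroup_val :> subgroup G ;
  stable_subgroup_closed : closed (stable_subgroup_val : set G) ;
  stable_subgroup_stable :
    forall x, x \in (stable_subgroup_val : set G) ->
      sigma x \in (stable_subgroup_val : set G)
}.

Definition restrict_endo (H : stable_subgroup) (x : set_type H) : set_type H :=
  SigSub (stable_subgroup_stable (valP x)).

End Restriction.

Arguments restrict_endo {G sigma} H x.

Section FullShift.
Variable S : finGroupType.

Definition full_shift : Type :=
  prod_topology (fun _ : nat => discrete_topology S).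

HB.instance Definition _ := Topological.on full_shift.

Let mul (g h : full_shift) : full_shift := fun n => (g n : S) * (h n : S).
Let one : full_shift := fun=> (1 : S).
Let inv (g : full_shift) : full_shift := fun n => (g n : S)^-1.

Let mulA : associative mul.
Proof. by move=> f g h; apply/funext => n; exact: (@mulgA S). Qed.
Let mul1 : left_id one mul.
Proof. by move=> f; apply/funext => n; exact: (@mul1g S). Qed.
Let mulr1 : right_id one mul.
Proof. by move=> f; apply/funext => n; exact: (@mulg1 S). Qed.
Let mulV : left_inverse one inv mul.
Proof. by move=> f; apply/funext => n; exact: (@mulVg S). Qed.
Let mulrV : right_inverse one inv mul.
Proof. by move=> f; apply/funext => n; exact: (@mulgV S). Qed.

HB.instance Definition _ := isGroup.Build full_shift mulA mul1 mulr1 mulV mulrV.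

Lemma full_shift_nbhs (g : full_shift) n :
  nbhs g [set h : full_shift | h n = g n].
Proof.
have := @proj_continuous nat (fun=> discrete_topology S) n g [set g n].
by apply; exact: discrete_set1.
Qed.

Lemma full_shift_continuous (T : topologicalType) (f : T -> full_shift) :
  (forall t n, nbhs t [set u | f u n = f t n]) -> continuous f.
Proof.
move=> fn t; apply/cvg_sup => n A [B [[W oW <-] Wf] BA].
apply: filterS (fn t n) => u /= fun_; apply: BA => /=.
by rewrite fun_.
Qed.

Lemma full_shift_mul_continuous :
  continuous (fun x : full_shift * full_shift => x.1 * x.2).
Proof.
apply: full_shift_continuous => -[g h] n.
exists ([set u : full_shift | u n = g n], [set v : full_shift | v n = h n]).
  by split; exact: full_shift_nbhs.
by move=> [u v] [/= ug vh]; change (mul u v n = mul g h n); rewrite /mul ug vh.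
Qed.

Lemma full_shift_inv_continuous : continuous (fun x : full_shift => x^-1).
Proof.
apply: full_shift_continuous => g n; apply: filterS (full_shift_nbhs g n).
by move=> u /= ug; change (inv u n = inv g n); rewrite /inv ug.
Qed.

HB.instance Definition _ := isTopologicalGroup.Build full_shift
  full_shift_mul_continuous full_shift_inv_continuous.

Definition shift (g : full_shift) : full_shift := fun n => g n.+1.

End FullShift.

Section Series.
Variables (G : topGroupType) (sigma : G -> G).

(* The subgroup G_i of the series, for i = 1, ..., n, is [Gs i]; the simple
   group attached to G_i / G_{i+1}, for i = 1, ..., n-1, is [Ss i].  Other
   values of [Gs] and [Ss] are irrelevant. *)
Record shift_series (n : nat) (Gs : nat -> stable_subgroup sigma)
    (Ss : nat -> finGroupType) : Prop := ShiftSeries {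
  series_length : (1 <= n)%N ;
  series_subset : forall i, (1 <= i < n)%N -> Gs i.+1 `<=` Gs i ;
  series_normal : forall i, (1 <= i < n)%N ->
    normalised_by (Gs i) (Gs i.+1) ;
  series_normal_top :
    forall x y, x \in (Gs 1%N : set G) -> x ^ y \in (Gs 1%N : set G) ;
  series_simple : forall i, (1 <= i < n)%N -> simple [set: Ss i]%SET ;
  series_shift : forall i (hi : (1 <= i < n)%N),
    @isomorphic_with_endo
      (quotient_group (relative_normal_subgroup (series_normal hi)))
      (full_shift (Ss i))
      (quotient_endo (restrict_endo (Gs i))) (@shift (Ss i)) ;
  series_top :
    finite_set [set: quotient_group (NormalSubgroup series_normal_top)] /\
    topgroup_isomorphism
      (quotient_endo sigma :
        quotient_group (NormalSubgroup series_normal_top) ->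
        quotient_group (NormalSubgroup series_normal_top)) ;
  series_bottom :
    finite_set (Gs n : set G) /\
    exists2 k, (0 < k)%N &
      forall x : set_type (Gs n), iter k (restrict_endo (Gs n)) x = 1
}.

End Series.

(* Main.v *)
(* Fix an open subgroup N with trivial intersection of the sigma^-n(N), and let
   K_n be the intersection of sigma^-i(N) for i < n.  The indices [K_n : K_(n+1)]
   decrease, so sigma maps K_(n+1) onto K_n for large n, and the images
   sigma^k(H) of a closed stable subgroup H stabilise.

   Existence.  Replacing G by sigma^k(G), let sigma be surjective, and induct on
   |ker sigma|.  There is an open normal M, contained in sigma(M), on which
   sigma is injective and contracted by its inverse.  Unless G is finite with
   sigma bijective, sigma^j(M) grows until C = ker sigma `&` sigma(M) is
   nontrivial.  Then C `&` M = 1, and V = {x | sigma^n(x) in CM for all n} is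
   normal, and it is the full shift on C via the C-components of the sigma^n(x);
   surjectivity holds because CM is contained in sigma(M).  The quotient G/V is
   expansive since V is the intersection of the sigma^-n(CM), and its kernel is
   smaller.  The last term P/V of a series of G/V is killed by some sigma^k, so
   sigma^k maps P onto V with finite kernel, which becomes the new last term.

   Uniqueness.  If T is open, normal and stable with sigma injective on G/T, it
   contains G_1: lifts of finitely supported sequences land in T.  The simple
   factors of a series starting at H are, for large k, the composition factors
   of the finite group ker sigma `&` sigma^k(H), since a normal stable subgroup
   of a full shift killed by a power of the shift is the kernel of a power; so
   the Jordan-Hoelder theorem applies. *)
From HB Require Import structures.
Require Import Defs.
From mathcomp Require Import all_boot fingroup morphism perm quotient gseries.
From mathcomp Require Import all_classical topology generic_quotient.

Set Implicit Arguments.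
Unset Strict Implicit.
Unset Printing Implicit Defensive.

Local Open Scope classical_set_scope.
Local Open Scope group_scope.

(** * Subgroups and compact topological groups *)

(** Arguments run on bare sets, which are easily intersected, pulled back and mapped forward; the
    packaged subgroup types are built only to form a group type or the final series. *)
Definition is_subgroup (G : groupType) (H : set G) : Prop :=
  [/\ H 1, forall x y, H x -> H y -> H (x * y) & forall x, H x -> H x^-1].

Definition normalises (G : groupType) (H L : set G) : Prop :=
  forall x y, L x -> H y -> L (x ^ y).

Section Words.
Variables (G : groupType) (H : set G) (sH : is_subgroup H).

Lemma sub1 : H 1. Proof. by case: sH. Qed.
Lemma subM x y : H x -> H y -> H (x * y). Proof. by case: sH => _ + _; exact. Qed.
Lemma subV x : H x -> H x^-1. Proof. by case: sH => _ _; exact. Qed.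
Lemma subVr x : H x^-1 -> H x. Proof. by move=> /subV; rewrite invgK. Qed.
Lemma subMl x y : H x -> H (x * y) -> H y.
Proof. by move=> /subV Hx Hxy; rewrite -(mulKg x y); exact: subM. Qed.
Lemma subMr x y : H y -> H (x * y) -> H x.
Proof. by move=> /subV Hx Hxy; rewrite -(mulgK y x); exact: subM. Qed.

End Words.

Lemma setI_subgroup (G : groupType) (H L : set G) : is_subgroup H -> is_subgroup L ->
  is_subgroup (H `&` L).
Proof.
move=> sH sL; split=> [|x y [? ?] [? ?]|x [? ?]]; split;
  by [exact: sub1|exact: subM|exact: subV].
Qed.

Section Homomorphisms.
Variables (K : groupType) (H : set K).
Hypothesis sH : is_subgroup H.

Section OneHom.
Variables (S : finGroupType) (phi : K -> S).
Hypothesis phiM : forall x y, H x -> H y -> phi (x * y) = phi x * phi y.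
Hypothesis phiS : forall s, exists2 x, H x & phi x = s.

Lemma subhom1 : phi 1 = 1.
Proof. by apply: (@mulgI _ (phi 1)); rewrite -phiM ?mulg1 //; exact: sub1. Qed.

Lemma subhomV x : H x -> phi x^-1 = (phi x)^-1.
Proof.
move=> Hx; apply: (@mulgI _ (phi x)); rewrite -phiM ?mulgV ?subhom1 //.
exact: subV.
Qed.

Lemma subhom_ratio x y : H x -> H y -> phi x = phi y -> phi (x^-1 * y) = 1.
Proof. by move=> Hx Hy xy; rewrite phiM ?subhomV ?xy ?mulVg //; exact: subV. Qed.

Lemma subhomJ x y : H x -> H y -> phi (x ^ y) = phi x ^ phi y.
Proof.
move=> Hx Hy; have HyV := subV sH Hy.
by rewrite !conjgE phiM ?phiM ?subhomV //; exact: subM.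
Qed.

End OneHom.

End Homomorphisms.

(* Pointed alias: [compact_cover] is only stated for pointed spaces. *)
Definition pointed_group (G : topGroupType) : Type := G.
HB.instance Definition _ (G : topGroupType) := Topological.on (pointed_group G).
HB.instance Definition _ (G : topGroupType) :=
  isPointed.Build (pointed_group G) (1 : G).

(** * Compactness arguments with open subgroups *)

Section Topology.
Variable G : topGroupType.

Lemma mulgl_continuous (a : G) : continuous (fun x : G => a * x).
Proof.
move=> x; apply: (@continuous_comp _ _ _ (fun x => (a, x)) (fun z : G * G => z.1 * z.2)).
  by apply: cvg_pair; [exact: cvg_cst|exact: cvg_id].
exact: mulg_continuous.
Qed.

Lemma mulgr_continuous (a : G) : continuous (fun x : G => x * a).
Proof.
move=> x; apply: (@continuous_comp _ _ _ (fun x => (x, a)) (fun z : G * G => z.1 * z.2)).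
  by apply: cvg_pair; [exact: cvg_id|exact: cvg_cst].
exact: mulg_continuous.
Qed.

Lemma open_preimage (T T' : topologicalType) (f : T -> T') (A : set T') :
  continuous f -> open A -> open (f @^-1` A).
Proof. by move=> fc oA; apply: open_comp => // x _; exact: fc. Qed.

Lemma closed_preimage (T T' : topologicalType) (f : T -> T') (A : set T') :
  continuous f -> closed A -> closed (f @^-1` A).
Proof. by move=> fc; apply: preimage_closed. Qed.

Lemma conjg_continuous (a : G) : continuous (fun x : G => x ^ a).
Proof.
have -> : (fun x : G => x ^ a) = (fun x => a^-1 * x) \o (fun x => x * a).
  by apply/funext => x /=; rewrite conjgE.
by move=> x; apply: continuous_comp; [exact: mulgr_continuous|exact: mulgl_continuous].
Qed.

Lemma finite_cosets (U : set G) : compact [set: G] -> open U -> U 1 ->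
  exists xs : seq G, forall g, exists2 x, x \in xs & U (x^-1 * g).
Proof.
move=> cG oU U1.
have : @compact (pointed_group G) setT by [].
rewrite compact_cover => {}cG.
have [|g _|D _ cD] := cG G setT (fun x => (fun g => x^-1 * g) @^-1` U).
- by move=> x _; apply: (@open_preimage G G) oU; exact: mulgl_continuous.
- by exists g => //=; rewrite mulVg.
by exists (finmap.enum_fset D) => g; have [x xD Ux] := cD g I; exists x.
Qed.

Lemma open_subgroup (H V : set G) : is_subgroup H -> open V -> V 1 -> V `<=` H -> open H.
Proof.
move=> sH oV V1 VH; rewrite openE => x Hx.
rewrite /interior nbhsE; exists ((fun g => x^-1 * g) @^-1` V) => /=.
  split; first by apply: open_preimage oV; exact: mulgl_continuous.
  by rewrite /= mulVg.
by move=> g /= /VH Hg; rewrite -(mulKVg x g); exact: subM.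
Qed.

Lemma open_subgroup_closed (H : set G) : is_subgroup H -> open H -> closed H.
Proof.
move=> sH oH; rewrite -openC openE => x nHx.
rewrite /interior nbhsE; exists ((fun g => x^-1 * g) @^-1` H) => /=.
  split; first by apply: open_preimage oH; exact: mulgl_continuous.
  by rewrite /= mulVg; exact: sub1.
by move=> g /= Hxg Hg; apply: nHx; apply: subVr => //; exact: (subMr sH Hg).
Qed.

Hypothesis cG : compact [set: G].

(** Each [P n] is a union of left cosets of the open subgroup [U], and there are finitely many of
    these, so a decreasing sequence settles. This takes the place of counting indices. *)
Lemma stabilise (U : set G) (P : nat -> set G) : open U -> is_subgroup U ->
  (forall n x u, P n x -> U u -> P n (x * u)) ->
  (forall n x, P n.+1 x -> P n x) ->
  exists n0, forall n x, (n0 <= n)%N -> P n0 x -> P n x.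
Proof.
move=> oU sU PU Pdec.
have Pdec' n m x : (n <= m)%N -> P m x -> P n x.
  by move=> /subnK <-; elim: (m - n)%N => [//|k IH]; rewrite addSn => /Pdec/IH.
have [xs xsP] := finite_cosets cG oU (sub1 sU).
have [n0 n0P] : exists n0, forall x n, x \in xs -> (n0 <= n)%N -> P n0 x -> P n x.
  elim: xs {xsP} => [|x xs [n0 IH]]; first by exists 0%N.
  (* If [x] leaves the sequence at index n, that n serves as [nx]: the premise [P nx x] is then
     false. *)
  have [nx nxP] : exists nx, forall n, (nx <= n)%N -> P nx x -> P n x.
    have [aP|/existsNP[n nP]] := pselect (forall n, P n x).
      by exists 0%N => n _ _.
    by exists n => m _ /nP.
  exists (maxn n0 nx) => y n; rewrite in_cons => /orP[/eqP->|yxs];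
    rewrite geq_max => /andP[n1 n2] Py.
    by apply: nxP => //; apply: Pdec' Py; rewrite leq_maxr.
  by apply: IH => //; apply: Pdec' Py; rewrite leq_maxl.
exists n0 => n g n0n Pg.
have [x xxs Ux] := xsP g.
have Px : P n0 x.
  by have := PU _ _ _ Pg (subV sU Ux); rewrite invgM invgK mulKVg.
by rewrite -(mulKVg x g); apply: PU => //; exact: n0P Px.
Qed.

Lemma nested_closed (F : nat -> set G) :
  (forall n, closed (F n)) -> (forall n x, F n.+1 x -> F n x) ->
  (forall n, exists x, F n x) -> exists x, forall n, F n x.
Proof.
move=> Fc Fdec Fne; apply: contrapT => /forallNP nF.
have Fdec' n m x : (n <= m)%N -> F m x -> F n x.
  by move=> /subnK <-; elim: (m - n)%N => [//|k IH]; rewrite addSn => /Fdec/IH.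
have : @compact (pointed_group G) setT by exact: cG.
rewrite compact_cover => /(_ nat setT (fun n => ~` F n)) [].
- by move=> n _; rewrite openC.
- by move=> x _; have /existsNP[n nFn] := nF x; exists n.
move=> D _ DF; have [x Fx] := Fne (\max_(n <- finmap.enum_fset D) n)%N.
have [n nD] := DF x I; apply; apply: Fdec' Fx.
exact: leq_bigmax_seq.
Qed.

End Topology.

(** * Expansive endomorphisms *)

Definition stable (T : Type) (sigma : T -> T) (H : set T) : Prop :=
  forall x, H x -> H (sigma x).

Definition closed_stable (G : topGroupType) (sigma : G -> G) (H : set G) : Prop :=
  [/\ is_subgroup H, closed H & stable sigma H].

Definition expansive_nbhd (G : topGroupType) (sigma : G -> G) (N : set G) : Prop :=
  [/\ is_subgroup N, open N & forall x, (forall n, N (iter n sigma x)) -> x = 1].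

(* The map phi is the zeroth coordinate of an equivariant surjection from H
   onto the full shift on S with kernel L; its values off H are irrelevant. *)
Definition shift_factor (G : topGroupType) (sigma : G -> G) (H L : set G)
    (S : finGroupType) (phi : G -> S) : Prop :=
  [/\ forall x y, H x -> H y -> phi (x * y) = phi x * phi y,
      exists2 V : set G, open V /\ V 1 & forall x, V x -> H x -> phi x = 1,
      forall x, L x <-> H x /\ forall n, phi (iter n sigma x) = 1
    & forall s : nat -> S, exists2 x, H x & forall n, phi (iter n sigma x) = s n].

(** A series read from [H] downwards, with coordinate maps instead of quotient groups. Finiteness of
    the last term is not recorded; under expansiveness it follows from [killed_finite]. *)
Inductive chain (G : topGroupType) (sigma : G -> G) :
    set G -> seq finGroupType -> Prop :=
| chain_nil H k : closed_stable sigma H ->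
    (forall x, H x -> iter k sigma x = 1) -> chain sigma H [::]
| chain_cons H L (S : finGroupType) (phi : G -> S) l : closed_stable sigma H ->
    shift_factor sigma H L phi -> simple [set: S]%SET ->
    chain sigma L l -> chain sigma H (S :: l).

Lemma open_bigcap_seq (T : topologicalType) (I : eqType) (s : seq I) (F : I -> set T) :
  (forall i, open (F i)) -> open (\bigcap_(i in [set` s]) F i).
Proof.
move=> oF; elim: s => [|i s IH].
  by rewrite (_ : \bigcap_(_ in _) _ = setT); [exact: openT|exact/seteqP].
rewrite (_ : \bigcap_(_ in _) _ = F i `&` \bigcap_(j in [set` s]) F j);
  first exact: openI.
apply/seteqP; split=> [x Fx|x [Fix Fsx] j /=].
  by split=> [|j js]; apply: Fx; rewrite /= in_cons ?eqxx // js orbT.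
by rewrite in_cons => /orP[/eqP->|/Fsx].
Qed.

(** The intersection of all conjugates of [U] is already the intersection over finitely many coset
    representatives, hence open. *)
Lemma normal_core (G : topGroupType) (U : set G) : compact [set: G] ->
  is_subgroup U -> open U ->
  exists N : set G,
    [/\ is_subgroup N, open N, normalises setT N & N `<=` U].
Proof.
move=> cG sU oU; have [xs xsP] := finite_cosets cG oU (sub1 sU).
exists [set g | forall x, U (g ^ x)]; split.
- split=> [x|g h Ng Nh x|g Ng x] /=; first by rewrite conj1g; exact: sub1.
    by rewrite conjMg; apply: subM.
  by rewrite conjVg; apply: subV.
- have -> : [set g | forall x, U (g ^ x)] =
      \bigcap_(x in [set` xs]) ((fun g => g ^ x) @^-1` U).
    apply/seteqP; split=> [g Ng x _|g Ng x] /=; first exact: Ng.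
    have [y yxs Uyx] := xsP x; rewrite -(mulKVg y x) conjgM.
    by rewrite conjgE; apply: subM => //; [exact: subV|apply: subM => //; exact: Ng].
  by apply: open_bigcap_seq => x; apply: open_preimage oU; exact: conjg_continuous.
- by move=> g y /= Ng _ x; rewrite -conjgM.
- by move=> g /(_ 1); rewrite conjg1.
Qed.

(** * Windows of an expansive endomorphism and images of its powers *)

Section Endo.
Variables (G : topGroupType) (sigma : G -> G).
Hypothesis sM : {morph sigma : x y / x * y}.

Lemma endo_iterM n : {morph iter n sigma : x y / x * y}.
Proof. by elim: n => [//|n IH] x y; rewrite !iterS IH sM. Qed.

Lemma endo_iter1 n : iter n sigma 1 = 1.
Proof. by apply: (@mulgI _ (iter n sigma 1)); rewrite -endo_iterM !mulg1. Qed.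

Lemma endo_iterV n x : iter n sigma x^-1 = (iter n sigma x)^-1.
Proof. by apply: (@mulgI _ (iter n sigma x)); rewrite -endo_iterM !mulgV endo_iter1. Qed.

Lemma endo_iterJ n x y : iter n sigma (x ^ y) = iter n sigma x ^ iter n sigma y.
Proof. by rewrite !conjgE !endo_iterM endo_iterV. Qed.

Lemma endo1 : sigma 1 = 1. Proof. exact: (endo_iter1 1). Qed.
Lemma endoV x : sigma x^-1 = (sigma x)^-1. Proof. exact: (endo_iterV 1). Qed.
Lemma endoJ x y : sigma (x ^ y) = sigma x ^ sigma y. Proof. exact: (endo_iterJ 1). Qed.

Lemma stable_iter (H : set G) n x : stable sigma H -> H x -> H (iter n sigma x).
Proof. by move=> tH Hx; elim: n => [//|n IH]; exact: tH. Qed.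

Lemma image_subgroup (H : set G) n : is_subgroup H -> is_subgroup (iter n sigma @` H).
Proof.
move=> sH; split=> [|_ _ [x Hx <-] [y Hy <-]|_ [x Hx <-]].
- by exists 1; [exact: sub1|exact: endo_iter1].
- by exists (x * y); [exact: subM|exact: endo_iterM].
- by exists x^-1; [exact: subV|exact: endo_iterV].
Qed.

Lemma killed_subgroup n : is_subgroup [set x | iter n sigma x = 1].
Proof.
split=> [|x y /= ex ey|x /= ex];
  rewrite /= ?endo_iter1 ?endo_iterM ?endo_iterV ?ex ?ey ?mulg1 //.
exact: invg1.
Qed.

Hypothesis sC : continuous sigma.

Lemma iter_continuous n : continuous (iter n sigma).
Proof.
elim: n => [|n IH] x; first exact: cvg_id.
by apply: (@continuous_comp _ _ _ (iter n sigma) sigma); [exact: IH|exact: sC].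
Qed.

Hypothesis cG : compact [set: G].
Variable N : set G.
Hypothesis eN : expansive_nbhd sigma N.

Let sN : is_subgroup N. Proof. by case: eN. Qed.
Let oN : open N. Proof. by case: eN. Qed.

(** The K_n of the opening sketch: [window 0] is all of [G] and [window 1] is [N]. *)
Definition window n : set G := [set x | forall i, (i < n)%N -> N (iter i sigma x)].

Lemma window_subgroup n : is_subgroup (window n).
Proof.
split=> [i _|x y Kx Ky i lin|x Kx i lin]; rewrite ?endo_iter1 ?endo_iterM ?endo_iterV.
- exact: sub1.
- by apply: subM; [|exact: Kx|exact: Ky].
- by apply: subV => //; exact: Kx.
Qed.

Lemma windowS n x : window n.+1 x <-> window n x /\ N (iter n sigma x).
Proof.
split=> [Kx|[Kx Nx] i].
  by split=> [i lin|]; apply: Kx; rewrite // ltnS ltnW.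
by rewrite ltnS leq_eqVlt => /orP[/eqP->//|]; exact: Kx.
Qed.

Lemma window_open n : open (window n).
Proof.
elim: n => [|n IH]; first by rewrite (_ : window 0 = setT); [exact: openT|exact/seteqP].
rewrite (_ : window n.+1 = window n `&` iter n sigma @^-1` N).
  by apply: openI => //; apply: open_preimage oN; exact: iter_continuous.
by apply/seteqP; split=> x /windowS.
Qed.

Lemma windowSl n x : window n.+1 x <-> N x /\ window n (sigma x).
Proof.
split=> [Kx|[Nx Kx] [|i] //].
  by split=> [|i lin]; [exact: (Kx 0%N)|rewrite -iterSr; exact: Kx].
by rewrite ltnS iterSr; exact: Kx.
Qed.

Lemma window_le n m x : (n <= m)%N -> window m x -> window n x.
Proof. by move=> nm Kx i lin; apply: Kx; exact: leq_trans nm. Qed.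

Lemma window_all x : (forall n, window n x) -> x = 1.
Proof. by case: eN => _ _ + Kx; apply=> n; exact: (Kx n.+1). Qed.

(** Iterates of elements of [X] are 1 from [k] on, so by expansiveness only 1 lies in both [X] and
    [window k]. Each coset of [window k] therefore contains at most one point of [X]. *)
Lemma killed_finite (X : set G) k : is_subgroup X ->
  (forall x, X x -> iter k sigma x = 1) -> finite_set X.
Proof.
move=> sX Xk.
have XK x : X x -> window k x -> x = 1.
  move=> Xx Kx; case: eN => _ _; apply=> n; have [|kn] := ltnP n k; first exact: Kx.
  by rewrite -(subnK kn) iterD Xk // endo_iter1; exact: sub1.
have [xs xsP] := finite_cosets cG (window_open k) (sub1 (window_subgroup k)).
pose f g := xget 1 [set x | X x /\ window k (g^-1 * x)].
apply: (@sub_finite_set _ _ (f @` [set` xs])); last exact/finite_image/finite_seq.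
move=> x Xx; have [g gxs Kgx] := xsP x; exists g => //.
rewrite /f; case: xgetP => [y _ [Xy Kgy]|/(_ x)]; last by case; split.
apply/esym/(@mulgI _ y^-1); rewrite mulVg; apply: XK.
  by apply: subM => //; exact: subV.
rewrite -(mulKVg g x) mulgA; apply: (subM (window_subgroup k)) => //.
by apply: (subVr (window_subgroup k)); rewrite invgM invgK.
Qed.

Section Stabilisation.
Variable H : set G.
Hypothesis csH : closed_stable sigma H.

Let sH : is_subgroup H. Proof. by case: csH. Qed.
Let clH : closed H. Proof. by case: csH. Qed.
Let tH : stable sigma H. Proof. by case: csH. Qed.

(* The subgroups sigma^n (H `&` window n.+1) decrease, hence become constant
   modulo the open subgroup window 2. *)
Lemma window_lift_approx : exists n0, forall n x, (n0 <= n)%N -> H x -> window n.+1 x ->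
  exists2 y, H y /\ window n.+2 y & window n.+2 ((sigma y)^-1 * x).
Proof.
pose P n := [set z | exists x k,
  [/\ H x, window n.+1 x, window 2 k & z = iter n sigma x * k]].
have [||n0 n0P] := stabilise cG (window_open 2) (window_subgroup 2) (P := P).
- move=> n _ u [x [k [Hx Kx Kk ->]]] Ku; exists x, (k * u); split=> //;
    last by rewrite mulgA.
  exact: (subM (window_subgroup _)).
- move=> n _ [x [k [Hx Kx Kk ->]]]; exists (sigma x), k; split=> //;
    last by rewrite iterSr.
    exact: tH.
  by have [] := (windowSl n.+1 x).1 Kx.
exists n0 => n x n0n Hx Kx.
have Px : P n (iter n sigma x).
  by exists x, 1; split; rewrite ?mulg1 //; exact: (sub1 (window_subgroup _)).
have Pd m m' z : (m <= m')%N -> P m' z -> P m z.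
  move=> /subnK <-; elim: (m' - m)%N => [//|k IH]; rewrite addSn => Pz; apply: IH.
  case: Pz => [y [c [Hy Ky Kc ->]]]; exists (sigma y), c; split=> //;
    last by rewrite iterSr.
    exact: tH.
  by have [] := (windowSl _ y).1 Ky.
have [y [k [Hy Ky Kk xyk]]] : P n.+1 (iter n sigma x).
  by apply: (n0P n.+1); [exact: leqW|apply: Pd Px].
exists y => //; have Kz : window n.+1 ((sigma y)^-1 * x).
  apply: (subM (window_subgroup _)) => //.
  apply: (subV (window_subgroup _)).
  by have [] := (windowSl _ y).1 Ky.
(* The missing condition, of index [n.+1], says that [sigma k] lies in [N]. This is why [P] is taken
   modulo [window 2]. *)
apply/windowS; split=> //.
rewrite iterS endo_iterM endo_iterV -iterSr xyk mulKg.
by have := Kk 1%N isT.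
Qed.

(** Successive approximation: the error [(sigma y)^-1 * x] of an approximate preimage is itself
    lifted approximately, which improves [y] by one window. Compactness yields a [y] whose error
    lies in every window, hence is 1. *)
Lemma window_lift : exists n0, forall n x, (n0 <= n)%N -> H x -> window n x ->
  exists2 y, H y /\ window n.+1 y & sigma y = x.
Proof.
have [n0 n0P] := window_lift_approx; exists n0.+1 => -[//|n] x; rewrite ltnS => n0n Hx Kx.
pose F m := [set y | [/\ H y, window n.+2 y & window (n.+2 + m)%N ((sigma y)^-1 * x)]].
have [||m|y yF] := nested_closed cG (F := F).
- move=> m; rewrite (_ : F m = H `&` (window n.+2 `&`
      ((fun y => (sigma y)^-1 * x) @^-1` window (n.+2 + m)))); last first.
    by apply/seteqP; split=> [y []|y [? []]].
  apply: closedI => //; apply: closedI.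
    by apply: open_subgroup_closed; [exact: window_subgroup|exact: window_open].
  apply: closed_preimage.
    move=> y; apply: (@continuous_comp _ _ _ sigma (fun z => z^-1 * x)); first exact: sC.
    apply: (@continuous_comp _ _ _ (fun z : G => z^-1) (fun z => z * x)).
      exact: invg_continuous.
    exact: mulgr_continuous.
  by apply: open_subgroup_closed; [exact: window_subgroup|exact: window_open].
- by move=> m y [Hy Ky Kyx]; split=> //; apply: window_le Kyx; rewrite addnS.
- elim: m => [|m [y [Hy Ky Kyx]]].
    by have [y [Hy Ky] Kyx] := n0P n x n0n Hx Kx; exists y; split; rewrite ?addn0.
  have [||z [Hz Kz] Kzyx] := n0P (n.+1 + m)%N ((sigma y)^-1 * x) _ _ Kyx.
  + by apply: leq_trans (leq_addr _ _); exact: leqW.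
  + by apply: subM => //; apply: subV => //; exact: tH.
  exists (y * z); split; rewrite ?addnS; first exact: subM.
    apply: (subM (window_subgroup _)) => //.
    by apply: window_le Kz; exact: leq_trans (leq_addr m n.+2) (leqnSn _).
  by rewrite sM invgM -mulgA.
have [Hy Ky _] := yF 0%N; exists y => //.
apply/esym/(@mulgI _ (sigma y)^-1); rewrite mulVg; apply: window_all => m.
by have [_ _] := yF m; apply: window_le; exact: leq_addl.
Qed.

(** By [window_lift], every image sigma^k(H) contains [H] intersected with [window n0]. So it
    suffices that the images stabilise modulo the open subgroup [window n0]: the correcting factor
    [c] lies in [H] and is itself an image. *)
Lemma image_stabilises : exists k0, forall k x, (k0 <= k)%N -> H x ->
  exists2 y, H y & iter k.+1 sigma y = iter k sigma x.
Proof.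
have [n0 n0P] := window_lift.
have lift k c : H c -> window n0 c -> exists2 y, H y & iter k sigma y = c.
  move=> Hc Kc; suff [y [Hy _] yc] : exists2 y, H y /\ window n0 y & iter k sigma y = c.
    by exists y.
  elim: k => [|k [y [Hy Ky] yc]]; first by exists c.
  have [z [Hz Kz] zy] := n0P n0 y (leqnn _) Hy Ky.
  by exists z; [split=> //; apply: window_le Kz|rewrite iterSr zy].
pose P k := [set z | exists x c, [/\ H x, window n0 c & z = iter k sigma x * c]].
have [||k0 k0P] := stabilise cG (window_open n0) (window_subgroup n0) (P := P).
- move=> k _ u [x [c [Hx Kc ->]]] Ku; exists x, (c * u); split=> //;
    last by rewrite mulgA.
  exact: (subM (window_subgroup _)).
- move=> k _ [x [c [Hx Kc ->]]]; exists (sigma x), c; split=> //; last by rewrite iterSr.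
  exact: tH.
exists k0 => k x k0k Hx.
have [y [c [Hy Kc xyc]]] : P k.+1 (iter k sigma x).
  apply: k0P; first exact: leqW.
  exists (iter (k - k0)%N sigma x), 1; split; first exact: stable_iter.
    exact: (sub1 (window_subgroup _)).
  by rewrite -iterD subnKC // mulg1.
have Hc : H c by apply: (subMl sH (x := iter k.+1 sigma y)); rewrite -?xyc;
  exact: stable_iter.
have [z Hz zc] := lift k.+1 c Hc Kc.
by exists (y * z); [exact: subM|rewrite endo_iterM zc -xyc].
Qed.

End Stabilisation.

End Endo.

(** * Coordinate maps to finite groups and refinement of shifts *)

Section Coordinates.
Variables (G : topGroupType) (sigma : G -> G).
Hypothesis sM : {morph sigma : x y / x * y}.
Hypothesis sC : continuous sigma.
Variables (H : set G) (D : finGroupType) (f : G -> D).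
Hypothesis csH : closed_stable sigma H.
Hypothesis fM : forall x y, H x -> H y -> f (x * y) = f x * f y.
Hypothesis fC : exists2 V : set G, open V /\ V 1 & forall x, V x -> H x -> f x = 1.

Let sH : is_subgroup H. Proof. by case: csH. Qed.
Let clH : closed H. Proof. by case: csH. Qed.
Let tH : stable sigma H. Proof. by case: csH. Qed.

(** Around a point off [H] use that [H] is closed; around a point of [H] the coordinate is constant
    on [H], since [f] is multiplicative there and trivial near 1. *)
Lemma open_coordinate (B : {pred D}) n :
  open (~` [set x | H x /\ f (iter n sigma x) \in B]).
Proof.
have [V [oV V1] fV] := fC; rewrite openE => x nPx; rewrite /interior nbhsE.
have [Hx|nHx] := pselect (H x); last first.
  exists (~` H); last by move=> y nHy [].
  by split=> //; rewrite openC.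
exists ((fun y => (iter n sigma x)^-1 * iter n sigma y) @^-1` V).
  split; last by rewrite /= mulVg.
  apply: open_preimage oV => y.
  apply: (@continuous_comp _ _ _ (iter n sigma) (fun z => (iter n sigma x)^-1 * z)).
    exact: iter_continuous.
  exact: mulgl_continuous.
move=> y /= Vxy [Hy By]; apply: nPx; split=> //.
have Hxn := stable_iter n tH Hx; have Hyn := stable_iter n tH Hy.
have : f ((iter n sigma x)^-1 * iter n sigma y) = 1.
  by apply: fV => //; apply: subM => //; exact: subV.
rewrite fM ?(subhomV sH fM) //; last exact: subV.
by move/(canRL (mulKVg _)); rewrite mulg1 => <-.
Qed.

Lemma closed_stable_coord (B : {group D}) :
  closed_stable sigma [set x | H x /\ forall n, f (iter n sigma x) \in B].
Proof.
split.
- split=> [|x y [Hx Bx] [Hy By]|x [Hx Bx]].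
  + by split=> [|n]; [exact: sub1|rewrite endo_iter1 ?(subhom1 sH fM)].
  + split=> [|n]; first exact: subM.
    by rewrite endo_iterM // fM ?groupM //; exact: stable_iter.
  + split=> [|n]; first exact: subV.
    by rewrite endo_iterV // (subhomV sH fM) ?groupV //; exact: stable_iter.
- rewrite (_ : [set x | _] = \bigcap_n ~` ~` [set x | H x /\ f (iter n sigma x) \in B]).
    by apply: closed_bigI => n _; rewrite closedC; exact: open_coordinate.
  apply/seteqP; split=> [x [Hx Bx] n _|x Px]; rewrite ?setCK //.
  split=> [|n]; first by have := Px 0%N I; rewrite setCK => -[].
  by have := Px n I; rewrite setCK => -[].
- move=> x [Hx Bx]; split=> [|n]; first exact: tH.
  by rewrite -iterSr; exact: Bx.
Qed.

End Coordinates.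

Section Refinement.
Variables (G : topGroupType) (sigma : G -> G).
Hypothesis sM : {morph sigma : x y / x * y}.

Lemma shift_factor_normal (H L : set G) (S : finGroupType) (phi : G -> S) :
  closed_stable sigma H -> shift_factor sigma H L phi -> L `<=` H /\ normalises H L.
Proof.
move=> [sH _ tH] [phiM _ LE _]; split=> [x /LE[]//|x y /LE[Hx x1] Hy]; apply/LE;
  split=> [|n].
  by rewrite conjgE; apply: subM => //; [exact: subV|exact: subM].
by rewrite endo_iterJ // (subhomJ sH phiM) ?x1 ?conj1g //; exact: stable_iter.
Qed.

Hypothesis sC : continuous sigma.

(** Here the alphabet [D] is an arbitrary finite group. Induction on its order: a maximal normal
    subgroup [N] splits the shift on [D] into the shift on [N] and the shift on the simple group
    D/N. *)
Lemma chain_refine (D : finGroupType) (P : set G) (f : G -> D) k :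
  closed_stable sigma P ->
  (forall x y, P x -> P y -> f (x * y) = f x * f y) ->
  (exists2 V : set G, open V /\ V 1 & forall x, V x -> P x -> f x = 1) ->
  (forall s : nat -> D, exists2 x, P x & forall n, f (iter n sigma x) = s n) ->
  (forall x, P x -> (forall n, f (iter n sigma x) = 1) -> iter k sigma x = 1) ->
  exists l, chain sigma P l.
Proof.
have [m] := ubnP #|D|; elim: m D P f => // m IH D P f cD csP fM fC fS fk.
have tP : stable sigma P by case: csP.
have [D1|ntD] := eqVneq [set: D]%SET 1%g.
  exists [::]; apply: (chain_nil (k := k)) => // x Px; apply: fk => // n.
  by apply/set1gP; rewrite -D1 inE.
have [N maxN] := @ex_maxnormal_ntrivg _ [set: D]%G ntD.
have nsN : N <| [set: D]%G by exact: maxnormal_normal maxN.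
have NT x : x \in 'N(N) by apply: (fintype.subsetP (normal_norm nsN)); rewrite inE.
have [V [oV V1] fV] := fC.
(* The preimage of the full shift on [N]; it is the kernel of the map of [P] to the shift on D/N. *)
pose P1 := [set x | P x /\ forall n, f (iter n sigma x) \in N].
have csP1 : closed_stable sigma P1 by exact: closed_stable_coord.
have P1f x : P1 x -> f x \in N by case=> _ /(_ 0%N).
have P1t x n : P1 x -> P1 (iter n sigma x) by apply: stable_iter; case: csP1.
have [||||||l cl] := IH (subg_of N) P1 (fun x => subg N (f x)) => //.
- rewrite card_sub (eq_card (B := N)) // -ltnS.
  apply: leq_trans cD; rewrite ltnS -cardsT; apply: proper_card.
  exact: maxnormal_proper maxN.
- by move=> x y P1x P1y; rewrite fM ?subgM ?P1f //; [case: P1x|case: P1y].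
- exists V => // x Vx [Px _]; apply: val_inj; rewrite fV // subgK //; exact: group1.
- move=> s; have [x Px xs] := fS (fun n => val (s n)).
  exists x => [|n]; last by rewrite xs sgvalK.
  by split=> // n; rewrite xs subgP.
- move=> x P1x fx; apply: fk => [|n]; first by case: P1x.
  by have /(congr1 val) := fx n; rewrite /= subgK //; exact/P1f/P1t.
exists ((coset_of N : finGroupType) :: l);
  apply: (@chain_cons G sigma P P1 (coset_of N) (fun x => coset N (f x))) => //.
- split.
  + by move=> x y Px Py; rewrite fM // morphM ?NT.
  + by exists V => // x Vx Px; rewrite fV // coset_id.
  + move=> x; split=> -[Px fx]; split=> // n; first exact: coset_id.
    exact: coset_idr.
  + move=> s; have [x Px xs] := fS (fun n => fingroup.repr (s n)).
    by exists x => // n; rewrite xs coset_reprK.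
- have -> : [set: coset_of N]%SET = ([set: D]%G / N)%g.
    apply/setP => A; rewrite inE; apply/esym; have [x Nx ->] := cosetP A.
    by apply: mem_quotient; rewrite inE.
  by rewrite quotient_simple.
Qed.

Variables (Q : topGroupType) (tau : Q -> Q) (p : G -> Q).
Hypothesis pM : {morph p : x y / x * y}.
Hypothesis pC : continuous p.
Hypothesis ps : forall x, p (sigma x) = tau (p x).
Hypothesis pS : forall y, exists x, p x = y.

Lemma equivariant_iter n x : p (iter n sigma x) = iter n tau (p x).
Proof. by elim: n => //= n IH; rewrite ps IH. Qed.

Lemma hom1 : p 1 = 1.
Proof. by apply: (@mulgI _ (p 1)); rewrite -pM !mulg1. Qed.

Lemma homV x : p x^-1 = (p x)^-1.
Proof. by apply: (@mulgI _ (p x)); rewrite -pM !mulgV hom1. Qed.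

Lemma closed_stable_preimage H : closed_stable tau H -> closed_stable sigma (p @^-1` H).
Proof.
move=> [sH clH tH]; split.
- split=> [|x y /= Hx Hy|x /= Hx]; rewrite /= ?hom1 ?pM ?homV; first exact: sub1.
    exact: subM.
  exact: subV.
- exact: closed_preimage.
- by move=> x /= Hx; rewrite /= ps; exact: tH.
Qed.

(** Shift factors pull back by composing coordinates with [p]. The last term is left to [base],
    because its preimage need not be killed by a power of [sigma]. *)
Lemma chain_pullback H l : chain tau H l ->
  (forall F k, closed_stable tau F -> (forall x, F x -> iter k tau x = 1) ->
     exists l', chain sigma (p @^-1` F) l') ->
  exists l', chain sigma (p @^-1` H) l'.
Proof.
move=> + base; elim=> {H l} [H k csH Hk|
  H L S phi l csH [fM [V [oV V1] fV] fL fS] simS _ [l' cl']].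
  exact: base csH Hk.
exists (S :: l').
apply: (@chain_cons _ _ _ (p @^-1` L) S (phi \o p)) => //.
  exact: closed_stable_preimage.
split=> /=.
- by move=> x y Hx Hy; rewrite pM fM.
- exists (p @^-1` V) => [|x Vx Hx]; last exact: fV.
  by split; [exact: open_preimage oV|rewrite /= hom1].
- move=> x; rewrite fL; split=> -[Hx fx]; split=> // n.
    by rewrite equivariant_iter.
  by rewrite -equivariant_iter.
- move=> s; have [y Hy ys] := fS s; have [x xy] := pS y.
  by exists x => [|n]; rewrite ?xy // equivariant_iter xy.
Qed.

End Refinement.

(** Serves to make the finite group [step_kernel] the alphabet of a full shift. *)
Lemma finite_subgroup_type (K : groupType) (C : set K) :
  is_subgroup C -> finite_set C ->
  exists (D : finGroupType) (i : D -> K),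
    [/\ {morph i : x y / x * y}, injective i, forall d, C (i d)
      & forall x, C x -> exists d, i d = x].
Proof.
move=> sC /finite_seqP[s Cs].
have sP x : C x <-> x \in s by rewrite Cs.
pose T := seq_sub s.
have TC (u : T) : C (val u) by apply/sP; exact: valP.
pose mk x (Cx : C x) : T := SeqSub ((sP x).1 Cx).
pose mul (u v : T) := mk _ (subM sC (TC u) (TC v)).
pose inv (u : T) := mk _ (subV sC (TC u)).
have mulA : associative mul by move=> u v w; apply: val_inj; exact: mulgA.
have mul1 : left_id (mk _ (sub1 sC)) mul by move=> u; apply: val_inj; exact: mul1g.
have mulV : left_inverse (mk _ (sub1 sC)) inv mul by move=> u; apply: val_inj;
  exact: mulVg.
pose D : finGroupType := HB.pack T (Finite_isGroup.Build T mulA mul1 mulV).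
exists D, (fun u : T => val u); split.
- by [].
- exact: (@val_inj _ _ T).
- exact: TC.
- move=> x Cx.
by exists (mk x Cx).
Qed.

(** * Quotients and restrictions *)

Lemma is_subgroup_closed (K : groupType) (H : set K) : is_subgroup H ->
  group_closed (mem H).
Proof.
move=> sH; split=> [|x y /set_mem Hx /set_mem Hy]; apply/mem_set; first exact: sub1.
by apply: subM => //; exact: subV.
Qed.

Lemma subgroup_is_subgroup (K : groupType) (H : subgroup K) : is_subgroup (H : set K).
Proof.
have cH := subgroup_closed H; split=> [|x y Hx Hy|x Hx]; apply: set_mem.
- by case: cH.
- by apply: (group_closedM cH); exact: mem_set.
- by apply: (group_closedV cH); exact: mem_set.
Qed.

Section QuotientDynamics.
Variables (K : topGroupType) (sigma : K -> K) (N : normal_subgroup K).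
Hypothesis sM : {morph sigma : x y / x * y}.
Hypothesis sC : continuous sigma.
Hypothesis tN : stable sigma (N : set K).

Local Open Scope quotient_scope.
Local Notation Q := (Defs.quotient_group N).
Local Notation pi := (\pi_(Defs.quotient_group N)).
Local Notation tau := (@quotient_endo K N sigma).

Lemma quotient_pi_eq x y : pi x = pi y <-> (N : set K) (x^-1 * y).
Proof. by split=> [/coset_piP/set_mem|/mem_set/coset_piP]. Qed.

Lemma quotient_pi_eq1 x : pi x = 1 <-> (N : set K) x.
Proof.
have -> : (1 : Q) = pi 1 by [].
split=> [/esym/quotient_pi_eq|Nx]; first by rewrite invg1 mul1g.
by apply/esym/quotient_pi_eq; rewrite invg1 mul1g.
Qed.

Lemma quotient_pi_surj (q : Q) : exists x, pi x = q.
Proof. by exists (repr q); rewrite reprK. Qed.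

Lemma quotient_endo_pi x : tau (pi x) = pi (sigma x).
Proof. exact: quotient_endoE. Qed.

Lemma quotient_endo_iter n x : iter n tau (pi x) = pi (iter n sigma x).
Proof. by elim: n => //= n ->; rewrite quotient_endo_pi. Qed.

Lemma quotient_endo_morph : {morph tau : x y / x * y}.
Proof.
move=> a b; have [[x <-] [y <-]] := (quotient_pi_surj a, quotient_pi_surj b).
by rewrite -quotient_piM !quotient_endo_pi sM quotient_piM.
Qed.

Lemma quotient_endo_continuous : continuous tau.
Proof.
apply/quotient_continuous.
rewrite (_ : _ \o _ = pi \o sigma); last by apply/funext => x /=;
  rewrite quotient_endo_pi.
by move=> x; apply: continuous_comp; [exact: sC|exact: quotient_pi_continuous].
Qed.

Lemma quotient_compact : compact [set: K] -> compact [set: Q].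
Proof.
move=> cK; have -> : [set: Q] = pi @` [set: K].
  by apply/seteqP; split=> // q _; have [x <-] := quotient_pi_surj q; exists x.
apply: continuous_compact cK; apply: continuous_subspaceT; exact: quotient_pi_continuous.
Qed.

End QuotientDynamics.

Section Restriction.
Variables (G : topGroupType) (sigma : G -> G) (H : stable_subgroup sigma).
Hypothesis sM : {morph sigma : x y / x * y}.
Hypothesis sC : continuous sigma.
Local Notation R := (restrict_endo H).

Lemma set_val_continuous : continuous (set_val : set_type H -> G).
Proof. exact: initial_continuous. Qed.

Lemma restrict_iter n x : val (iter n R x) = iter n sigma (val x).
Proof. by elim: n => //= n <-. Qed.

Lemma restrict_morph : {morph R : x y / x * y}.
Proof. by move=> x y; apply: val_inj; exact: sM. Qed.

Lemma restrict_continuous : continuous R.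
Proof.
apply: continuous_comp_initial => x.
apply: (@continuous_comp _ _ _ (set_val : set_type H -> G) sigma).
  exact: set_val_continuous.
exact: sC.
Qed.

Lemma stable_subgroup_closed_stable : closed_stable sigma (H : set G).
Proof.
split; [exact: subgroup_is_subgroup|exact: stable_subgroup_closed|].
by move=> x Hx; apply/set_mem/stable_subgroup_stable/mem_set.
Qed.

Lemma restrict_compact : compact [set: G] -> compact [set: set_type H].
Proof.
move=> cG.
have cH : compact (H : set G).
  by apply: (subclosed_compact _ cG) => //; exact: stable_subgroup_closed.
move=> F PF _.
(* A cluster point in [H] of the filter pushed forward to [G] is a cluster point of [F], as [H]
   carries the initial topology. *)
have FH : (fmap (set_val : set_type H -> G) F) (H : set G).
  by apply: (@filterS _ F _ setT) filterT => u _; exact: (set_mem (valP u)).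
have [p [Hp Fp]] := cH _ _ FH.
exists (SigSub (mem_set Hp)); split=> // A B FA [_ [[W oW <-] Wp WB]].
have [||_ [[u Au <-] Wu]] := Fp (set_val @` A) W.
- by apply: (@filterS _ F _ A) FA => u Au; exists u.
- by apply: open_nbhs_nbhs; split.
by exists u; split=> //; exact: WB.
Qed.

End Restriction.

(** * Existence *)

(** Internal form of the condition on the top quotient. For compact [G] that quotient is finite, so
    injectivity of the induced map, the last clause, gives an automorphism. *)
Definition open_top (G : topGroupType) (sigma : G -> G) (H : set G) : Prop :=
  [/\ is_subgroup H, open H, normalises setT H, stable sigma H
    & forall x, H (sigma x) -> H x].

Lemma open_top_preimage (G Q : topGroupType) (sigma : G -> G) (tau : Q -> Q)
    (p : G -> Q) (H : set Q) :
  {morph p : x y / x * y} -> continuous p -> (forall x, p (sigma x) = tau (p x)) ->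
  open_top tau H -> open_top sigma (p @^-1` H).
Proof.
move=> pM pC ps [sH oH nH tH iH]; split.
- split=> [|x y /= Hx Hy|x /= Hx]; rewrite /= ?(hom1 pM) ?pM ?(homV pM);
    first exact: sub1.
    exact: subM.
  exact: subV.
- exact: open_preimage oH.
- by move=> x y /= Hx _; rewrite conjgE !pM (homV pM) -conjgE; exact: nH.
- by move=> x /= Hx; rewrite ps; exact: tH.
- by move=> x /=; rewrite ps; exact: iH.
Qed.

Section SurjectiveEndo.
Variables (G : topGroupType) (sigma : G -> G).
Hypothesis sM : {morph sigma : x y / x * y}.
Hypothesis sC : continuous sigma.
Hypothesis sS : forall y, exists x, sigma x = y.
Hypothesis cG : compact [set: G].

Lemma iter_surj n y : exists x, iter n sigma x = y.
Proof.
elim: n y => [|n IH] y; first by exists y.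
by have [z <-] := sS y; have [x <-] := IH z; exists x.
Qed.

(* On such an M the endomorphism is injective, and its inverse contracts M. *)
Definition contractible (M : set G) : Prop :=
  [/\ expansive_nbhd sigma M, normalises setT M
    & forall x, M x -> exists2 y, M y & sigma y = x].

(** A late window of the normal core of [U] works: [window_lift] finds preimages inside it. *)
Lemma contractible_exists (U : set G) : expansive_nbhd sigma U ->
  exists M, contractible M.
Proof.
case=> sU oU eU; have [N [sN oN nN NU]] := normal_core cG sU oU.
have eN : expansive_nbhd sigma N by split=> // x Nx; apply: eU => n; exact: NU.
have csT : closed_stable sigma [set: G] by split.
have [n0 n0P] := window_lift sM sC cG eN csT.
exists (window sigma N n0.+1); split.
- split; [exact: window_subgroup|exact: window_open|].
  by move=> x Kx; apply: eU => n; apply: NU; exact: (Kx n 0%N).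
- move=> x y Kx _ i lin; rewrite endo_iterJ //; apply: nN => //; exact: Kx.
- move=> x Kx; have [y [_ Ky] yx] := n0P n0.+1 x (leqnSn _) I Kx.
  by exists y => //; exact: window_le Ky.
Qed.

Lemma contractible_killed M x : contractible M -> M x -> sigma x = 1 -> x = 1.
Proof.
case=> -[sN _ eM] _ _ Mx sx; apply: eM => -[//|n].
by rewrite iterSr sx endo_iter1 //; exact: sub1.
Qed.

Lemma contractible_sub M x : contractible M -> M x -> (sigma @` M) x.
Proof. by case=> _ _ lM /lM[y My yx]; exists y. Qed.

(** Normality survives because [sigma] is surjective. For expansiveness, injectivity on the image of
    [M] lets one recover that an orbit in the image comes from an orbit in [M]. *)
Lemma contractible_image M : contractible M ->
  (forall x, (sigma @` M) x -> sigma x = 1 -> x = 1) -> contractible (sigma @` M).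
Proof.
move=> cM inj; have [[sM' oM eM] nM lM] := cM.
have sI : is_subgroup (sigma @` M) by exact: (image_subgroup sM 1).
split.
- split=> //; first by apply: (open_subgroup sI oM (sub1 sM')) => x /(contractible_sub
    cM).
  move=> x Ix; have [y My /= yx] := Ix 0%N; subst x.
  suff -> : y = 1 by exact: (endo1 sM).
  apply: eM => n; elim: n => [//|n IH].
  (* Both [z] and the iterate of [y] lie in the image of [M] and have the same image under [sigma],
     so they agree. *)
  have [z Mz zy] := Ix n.+1.
  have e : iter n.+1 sigma y = z; last by rewrite e.
  apply/esym/(@mulgI _ (iter n.+1 sigma y)^-1); rewrite mulVg; apply: inj.
    apply: subM => //; last exact: contractible_sub.
    by apply: subV => //; exists (iter n sigma y).
  by rewrite sM (endoV sM) zy -[sigma (iter n.+1 sigma y)]iterS iterSr mulVg.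
- move=> _ y [x Mx <-] _; have [z <-] := sS y.
  by exists (x ^ z); [exact: nM|rewrite (endoJ sM)].
- by move=> _ [x Mx <-]; exists x => //; exact: contractible_sub.
Qed.

(** While the image of [M] meets the kernel trivially, replace [M] by its image. These groups
    increase and are unions of cosets of [M0], so the process stops; then [M] is [sigma]-stable and
    expansiveness makes it trivial. *)
Lemma contractible_grow M0 : contractible M0 ->
  exists2 M, contractible M & M = [set 1] \/
    exists c, [/\ c != 1, sigma c = 1 & (sigma @` M) c].
Proof.
move=> cM0; apply: contrapT => nM.
have grow M : contractible M -> contractible (sigma @` M).
  move=> cM; apply: contractible_image => // x Ix sx; apply: contrapT => /eqP x1.
  by apply: nM; exists M => //; right; exists x.
pose Ms j := iter j (fun A => sigma @` A) M0.
have cMs j : contractible (Ms j) by elim: j => [//|j IH]; exact: grow.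
have M0s j x : M0 x -> Ms j x.
  by elim: j x => [//|j IH] x /IH; exact: contractible_sub.
have [[sM0 oM0 _] _ _] := cM0.
(* Complements are used because [stabilise] treats decreasing sequences. *)
have [||n0 n0P] := stabilise cG oM0 sM0 (P := fun j => ~` Ms j).
- move=> j x u nMx /(M0s j) Mu Mxu; apply: nMx.
  by have [[sMj _ _] _ _] := cMs j; exact: (subMr sMj Mu).
- by move=> j x nMx Mx; apply: nMx; exact: contractible_sub.
apply: nM; exists (Ms n0) => //; left.
have [[sMn _ eMn] _ _] := cMs n0.
apply/seteqP; split=> [x Mx|_ ->]; last exact: sub1.
apply: eMn => n; apply: stable_iter => //= y My.
apply: contrapT => /(n0P n0.+1 _ (leqnSn _)); apply.
by exists y.
Qed.

(** The group is compact and discrete here. The kernels of the iterates stabilise, and writing a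
    kernel element as an n0-th iterate shows that it is 1. *)
Lemma discrete_top : contractible [set 1] ->
  open_top sigma [set 1] /\ chain sigma [set 1] [::].
Proof.
case=> -[s1 o1 e1] n1 _.
have t1 : stable sigma [set 1] by move=> _ ->; exact: endo1.
have [||n0 n0P] := stabilise cG o1 s1 (P := fun n => [set x | iter n sigma x <> 1]).
- by move=> n x _ nx ->; rewrite mulg1.
- by move=> n x /= nx x1; apply: nx; rewrite x1 endo1.
split.
  split=> // x /= sx; have [y yx] := iter_surj n0 x.
  rewrite -yx; apply: contrapT => /(n0P n0.+1 _ (leqnSn _)); apply.
  by rewrite iterS yx.
apply: (chain_nil (k := 0)) => //.
by split=> //; exact: open_subgroup_closed.
Qed.

(** * Splitting off one full shift *)

Section Step.
Variable M : set G.
Hypothesis cM : contractible M.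

Let sM' : is_subgroup M. Proof. by case: cM => -[]. Qed.
Let oM : open M. Proof. by case: cM => -[]. Qed.
Let eM : forall x, (forall n, M (iter n sigma x)) -> x = 1.
Proof. by case: cM => -[]. Qed.
Let nM : normalises setT M. Proof. by case: cM. Qed.
Let lM : forall x, M x -> exists2 y, M y & sigma y = x. Proof. by case: cM. Qed.

Definition step_kernel : set G := [set x | sigma x = 1 /\ (sigma @` M) x].
Local Notation C := step_kernel.

Lemma step_kernel_subgroup : is_subgroup C.
Proof.
by apply: (setI_subgroup (killed_subgroup sM 1)); exact: (image_subgroup sM 1).
Qed.

Definition step_thick : set G := [set x | exists c m, [/\ C c, M m & x = c * m]].
Local Notation A := step_thick.

Lemma step_thick_subgroup : is_subgroup A.
Proof.
have sC' := step_kernel_subgroup; split.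
- by exists 1, 1; split; rewrite ?mulg1 //; exact: sub1.
- move=> _ _ [c [m [Cc Mm ->]]] [d [n [Cd Mn ->]]].
  exists (c * d), (m ^ d * n); split; first exact: subM.
    by apply: subM => //; exact: nM.
  by rewrite conjgE !mulgA mulgK.
- move=> _ [c [m [Cc Mm ->]]]; exists c^-1, (m^-1 ^ c^-1); split; first exact: subV.
    by apply: nM => //; exact: subV.
  by rewrite conjgE invgK !mulgA mulVg mul1g invgM.
Qed.

Lemma step_thick_M x : M x -> A x.
Proof. by move=> Mx; exists 1, x; rewrite mul1g; split=> //;
  exact: (sub1 step_kernel_subgroup). Qed.

Lemma step_thick_open : open A.
Proof. exact: (open_subgroup step_thick_subgroup oM (sub1 sM') step_thick_M). Qed.

Lemma step_thick_normal : normalises setT A.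
Proof.
move=> _ y [c [m [[sc [z Mz zc]] Mm ->]]] _; exists (c ^ y), (m ^ y); split.
- split; first by rewrite (endoJ sM) sc conj1g.
  have [w <-] := sS y; exists (z ^ w); first exact: nM.
  by rewrite (endoJ sM) zc.
- exact: nM.
- by rewrite conjMg.
Qed.

(** [C] lies in the image of [M] by definition and [M] by contractibility. Surjectivity onto the
    shift rests on this. *)
Lemma step_thick_lift x : A x -> exists2 y, M y & sigma y = x.
Proof.
case=> c [m [[_ [z Mz <-]] /lM[w Mw <-] ->]].
by exists (z * w); [exact: subM|exact: sM].
Qed.

Definition step_shift : set G := [set x | forall n, A (iter n sigma x)].
Local Notation V := step_shift.

Lemma step_shift_sub x : V x -> A x. Proof. by move/(_ 0%N). Qed.

Lemma step_shift_closed_stable : closed_stable sigma V.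
Proof.
have sA := step_thick_subgroup; split.
- split=> [n|x y Vx Vy n|x Vx n]; rewrite ?endo_iter1 ?endo_iterM ?endo_iterV //.
  + exact: sub1.
  + exact: subM.
  + exact: subV.
- rewrite (_ : V = \bigcap_n (iter n sigma @^-1` A)).
    apply: closed_bigI => n _; apply: closed_preimage; first exact: iter_continuous.
    by apply: open_subgroup_closed => //; exact: step_thick_open.
  by apply/seteqP; split=> [x Vx n _|x Vx n]; [exact: Vx|exact: (Vx n I)].
- by move=> x Vx n; rewrite -iterSr; exact: Vx.
Qed.

Lemma step_shift_normal : normalises setT V.
Proof. by move=> x y Vx _ n; rewrite endo_iterJ //; exact: step_thick_normal. Qed.

(** [psi] is the [C]-component in A = CM. It is well defined since [C] meets [M] trivially, and
    multiplicative since [M] is normal. *)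
Lemma step_shift_factor : exists (D : finGroupType) (psi : G -> D),
  [/\ forall x y, A x -> A y -> psi (x * y) = psi x * psi y,
      forall x, A x -> psi x = 1 <-> M x,
      forall s : nat -> D, exists2 x, V x & forall n, psi (iter n sigma x) = s n
    & forall x, V x -> exists2 y, V y & sigma y = x].
Proof.
have eM' : expansive_nbhd sigma M by split.
have fC : finite_set C.
  by apply: (killed_finite sM sC cG eM' (k := 1) step_kernel_subgroup) => x [].
have [D [i [iM iI iC iS]]] := finite_subgroup_type step_kernel_subgroup fC.
have i1 : i 1 = 1 by apply: (@mulgI _ (i 1)); rewrite -iM !mulg1.
have iV d : i d^-1 = (i d)^-1 by apply: (@mulgI _ (i d)); rewrite -iM !mulgV.
(* The value 1 off [A] is a mere default. *)
pose psi x : D := odflt 1 [pick d | `[< M ((i d)^-1 * x) >]].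
have psi_uniq x d : M ((i d)^-1 * x) -> psi x = d.
  move=> Mdx; rewrite /psi; case: pickP => [e /asboolP Mex|/(_ d)/asboolP//].
  have Mde : M ((i d)^-1 * i e).
    apply: (subMr sM' Mex); rewrite -mulgA mulKVg //.
  apply/esym/iI/(@mulgI _ (i d)^-1); rewrite mulVg; apply/esym.
  apply: (contractible_killed cM) => //.
  by rewrite sM (endoV sM) (iC d).1 (iC e).1 mulVg.
have psiP x : A x -> M ((i (psi x))^-1 * x).
  case=> c [m [/iS[d <-] Mm ->]].
  by rewrite (psi_uniq _ d) mulKg.
have psiM x y : A x -> A y -> psi (x * y) = psi x * psi y.
  move=> /psiP Mx /psiP My; apply: psi_uniq.
  rewrite iM invgM -mulgA [(i (psi x))^-1 * _]mulgA.
  have -> : (i (psi y))^-1 * ((i (psi x))^-1 * x * y) =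
    ((i (psi x))^-1 * x) ^ i (psi y) * ((i (psi y))^-1 * y).
    by rewrite conjgE !mulgA mulgK.
  by apply: subM => //; exact: nM.
have psi1 x : A x -> psi x = 1 <-> M x.
  move=> Ax; split=> [x1|Mx]; first by have := psiP x Ax; rewrite x1 i1 invg1 mul1g.
  by apply: psi_uniq; rewrite i1 invg1 mul1g.
(* A preimage of [v] in [M] may be multiplied by any element of [C], so the component of the
   preimage can be prescribed. *)
have ext v d : V v -> exists y, [/\ V y, sigma y = v & psi y = d].
  move=> Vv; have [m Mm mv] := step_thick_lift (step_shift_sub Vv).
  have yv : sigma (i d * m) = v by rewrite sM (iC d).1 mul1g.
  exists (i d * m); split=> //; last by apply: psi_uniq; rewrite mulKg.
  by move=> [|n]; [exists (i d), m|rewrite iterSr yv].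
exists D, psi; split=> //; last by move=> x /(ext _ 1)[y [Vy yx _]]; exists y.
move=> s; have csV := step_shift_closed_stable; have [sV clV tV] := csV.
(* [ext] realises every finite prefix of [s], one letter at a time from the right; compactness then
   realises [s]. *)
pose F n := [set x | V x /\ forall j, (j < n)%N -> psi (iter j sigma x) = s j].
have fV : forall x y, V x -> V y -> psi (x * y) = psi x * psi y.
  by move=> x y /step_shift_sub Ax /step_shift_sub Ay; exact: psiM.
have fc : exists2 W : set G, open W /\ W 1 & forall x, W x -> V x -> psi x = 1.
  exists M; first by split=> //; exact: sub1.
  by move=> x Mx /step_shift_sub Ax; apply/psi1.
have [||n|x xF] := nested_closed cG (F := F).
- elim=> [|n IH].
    suff -> : F 0%N = V by [].
    by apply/seteqP; split=> [x [Vx _]//|x Vx]; split.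
  rewrite (_ : F n.+1 = F n `&` [set x | V x /\ psi (iter n sigma x) \in pred1 (s n)]).
    apply: closedI => //; rewrite -openC.
    exact: (open_coordinate sC csV fV fc).
  apply/seteqP; split=> [x [Vx xs]|x [[_ xs] [Vx /eqP xn]]].
    split; last by split=> //; apply/eqP; exact: xs.
    by split=> // j jn; apply: xs; exact: leqW.
  by split=> // j; rewrite ltnS leq_eqVlt => /orP[/eqP->//|]; exact: xs.
- by move=> n x [Vx xs]; split=> // j jn; apply: xs; exact: leqW.
- rewrite /F; elim: n s {F} => [|n IH] s; first by exists 1; split=> //; exact: sub1.
  have [v [Vv vs]] := IH (fun n => s n.+1).
  have [y [Vy yv y0]] := ext v (s 0%N) Vv.
  exists y; split=> // -[//|j] jn; rewrite iterSr yv; exact: vs.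
by exists x => [|n]; [case: (xF 0%N)|have [_] := xF n.+1; apply].
Qed.

End Step.

End SurjectiveEndo.

Lemma series_exist_surj m (G : topGroupType) (sigma : G -> G) :
  {morph sigma : x y / x * y} -> continuous sigma ->
  (forall y, exists x, sigma x = y) -> compact [set: G] ->
  (exists U, expansive_nbhd sigma U) ->
  (exists2 s : seq G, (size s <= m)%N & forall x, sigma x = 1 -> x \in s) ->
  exists H l, open_top sigma H /\ chain sigma H l.
Proof.
elim: m G sigma => [|m IH] G sigma sM sC sS cG [U eU] [s sm ks].
  (* A list containing the kernel contains 1, so it is not empty. *)
  by move: sm; rewrite leqn0 size_eq0 => /eqP s0; have := ks 1 (endo1 sM); rewrite s0.
have [M0 cM0] := contractible_exists sM sC cG eU.
have [M cM [M1|[c [c1 sc Ic]]]] := contractible_grow sM sS cG cM0.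
  by exists [set 1], [::]; apply: discrete_top => //; rewrite -M1.
have [[sM' oM eM] _ _] := cM.
pose V := step_shift sigma M; pose A := step_thick sigma M.
have [sV clV tV] := step_shift_closed_stable sM sC cM.
have nV := step_shift_normal sM sS cM.
have [D [psi [psiM psi1 psiS liftV]]] := step_shift_factor sM sC cG cM.
have VA x : V x -> A x by exact: step_shift_sub.
have sA : is_subgroup A := step_thick_subgroup sM cM.
pose VS := Subgroup (is_subgroup_closed sV).
have VSJ x y : x \in (VS : set G) -> x ^ y \in (VS : set G).
  by move=> /set_mem Vx; apply/mem_set; exact: nV.
pose N := NormalSubgroup VSJ.
pose Q := Defs.quotient_group N; pose tau : Q -> Q := quotient_endo sigma.
pose p : G -> Q := (\pi_Q)%qT.
have tN : stable sigma (N : set G) by [].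
have pE x : p (sigma x) = tau (p x) by rewrite /p /tau quotient_endo_pi.
have pS : forall y, exists x, p x = y by exact: quotient_pi_surj.
have pM : {morph p : x y / x * y} by exact: quotient_piM.
have pC : continuous p by exact: quotient_pi_continuous.
have p1 x : p x = 1 <-> V x by exact: quotient_pi_eq1.
have kV x : V (sigma x) -> exists2 y, V y & sigma (x * y^-1) = 1.
  by move=> /liftV[y Vy yx]; exists y => //; rewrite sM (endoV sM) yx mulgV.
have [H [l [tH cH]]] : exists H l, open_top tau H /\ chain tau H l.
  apply: IH.
  - exact: quotient_endo_morph.
  - exact: quotient_endo_continuous.
  - by move=> y; have [x <-] := pS y; have [z <-] := sS x; exists (p z); rewrite pE.
  - exact: quotient_compact.
  (* Since [V] lies in [A], the preimage of this set is [A]; an orbit staying in it comes from a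
     point of [V]. *)
  - exists (p @` A); split.
    + split=> [|_ _ [x Ax <-] [y Ay <-]|_ [x Ax <-]].
      * by exists 1; [exact: sub1|exact: hom1].
      * by exists (x * y); [exact: subM|exact: pM].
      * by exists x^-1; [exact: subV|exact: homV].
    + by apply: quotient_pi_open; exact: step_thick_open.
    + move=> q; have [x <-] := pS q => Ax; apply/p1 => n.
      have [a Aa] := Ax n; rewrite -(equivariant_iter pE) => /quotient_pi_eq /VA.
      exact: (subMl sA (subV sA Aa)).
  - exists (map p (rem c s)); first by rewrite size_map size_rem ?ks // -ltnS;
      case: s sm {ks} => //.
    move=> q; have [x <-] := pS q; rewrite -pE => /p1 /kV[y Vy /ks xys].
    have -> : p x = p (x * y^-1) by rewrite pM (homV pM) ((p1 y).2 Vy) invg1 mulg1.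
    have [->|xyc] := eqVneq (x * y^-1) c; last by apply: map_f; exact: rem_mem.
    have -> : p c = p 1.
      rewrite (hom1 pM); apply/p1 => -[|n].
        by exists c, 1; split; [split|exact: sub1|rewrite mulg1].
      by rewrite iterSr sc endo_iter1 //; exact: sub1.
    by apply: map_f; apply: rem_mem; [rewrite eq_sym|apply: ks; exact: endo1].
have [l' cl'] : exists l', chain sigma (p @^-1` H) l'.
  apply: (chain_pullback pM pC pE pS cH) => F k csF Fk.
  have csP := closed_stable_preimage pM pC pE csF.
  have PV x : (p @^-1` F) x -> V (iter k sigma x).
    by move=> /Fk; rewrite -(equivariant_iter pE) => /p1.
  (* The k-th iterate maps the preimage of [F] into [V], where [psi] reads off the shift; its kernel
     there is killed by that iterate. *)
  apply: (chain_refine sM sC (f := psi \o iter k sigma) (k := k) csP) => /=.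
  - by move=> x y /PV/VA Ax /PV/VA Ay; rewrite endo_iterM // psiM.
  - exists (iter k sigma @^-1` M) => [|x Mx /PV/VA Ax]; last exact/psi1.
    split; last by rewrite /= endo_iter1 //; exact: sub1.
    by apply: open_preimage oM; exact: iter_continuous.
  - move=> t; have [v Vv vt] := psiS t.
    have [x Vx xv] : exists2 x, V x & iter k sigma x = v.
      elim: (k) v Vv {vt} => [|j IHk] v Vv; first by exists v.
      have [y Vy <-] := liftV v Vv; have [x Vx <-] := IHk y Vy.
      by exists x.
    exists x => [|n]; first by rewrite /= ((p1 x).2 Vx); case: csF => sF _ _; exact: sub1.
    by rewrite -iterD addnC iterD xv.
  - move=> x Px fx; apply: eM => n.
    apply/psi1; first by apply: (PV x Px n).
    by rewrite -iterD addnC iterD.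
by exists (p @^-1` H), l'; split=> //; exact: open_top_preimage pM pC pE tH.
Qed.

(** The iterate of order [k0] is an equivariant surjection of [G] onto the stable image [J], so a
    series pulls back along it. The preimage of a last term killed by the k-th iterate is killed by
    the (k + k0)-th, so no factor is added. *)
Lemma series_exist (G : topGroupType) (sigma : G -> G) :
  endomorphism sigma -> compact [set: G] -> hausdorff_space G ->
  (exists U, expansive_nbhd sigma U) ->
  exists H l, open_top sigma H /\ chain sigma H l.
Proof.
move=> [sM sC] cG hG [U eU]; have [sU oU eU'] := eU.
have csT : closed_stable sigma [set: G] by split.
have [k0 k0P] := image_stabilises sM sC cG eU csT.
pose J := iter k0 sigma @` [set: G].
have sJ : is_subgroup J by exact: image_subgroup.
have clJ : closed J.
  apply: compact_closed => //; apply: continuous_compact cG.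
  by apply: continuous_subspaceT; exact: iter_continuous.
have tJ x : x \in J -> sigma x \in J.
  by move=> /set_mem[y _ <-]; apply/mem_set; exists (sigma y); rewrite // -iterS iterSr.
pose JS := @StableSubgroup G sigma (Subgroup (is_subgroup_closed sJ)) clJ tJ.
pose Q : topGroupType := set_type JS; pose tau : Q -> Q := restrict_endo JS.
pose p (x : G) : Q := SigSub (mem_set (imageT (iter k0 sigma) x) : iter k0 sigma x \in
  (JS : set G)).
have pS y : exists x, p x = y.
  have [x _ xy] := set_mem (valP y).
  by exists x; apply: val_inj.
have pM : {morph p : x y / x * y} by move=> x y; apply: val_inj; exact: endo_iterM.
have pC : continuous p.
  by apply: continuous_comp_initial; exact: iter_continuous.
have pE x : p (sigma x) = tau (p x) by apply: val_inj; rewrite /= -iterSr.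
have tauM := restrict_morph (H := JS) sM; have tauC := restrict_continuous (H := JS) sC.
have tauS y : exists x, tau x = y.
  have [x _ xy] := set_mem (valP y); have [z _ zx] := k0P k0 x (leqnn _) I.
  by exists (p z); apply: val_inj; rewrite /= -iterS zx.
have cQ : compact [set: Q] := restrict_compact (H := JS) cG.
have eQ : expansive_nbhd tau (set_val @^-1` U).
  split.
  - by split=> [|x y|x] /=; [exact: sub1|exact: subM|exact: subV].
  - by apply: open_preimage oU; exact: set_val_continuous.
  - move=> x Ux; apply: val_inj; apply: eU' => n; rewrite -(restrict_iter (H := JS));
      exact: Ux.
have /finite_seqP[s ks] : finite_set [set x : Q | tau x = 1].
  by apply: (killed_finite tauM tauC cQ eQ (k := 1)) => //;
    exact: (killed_subgroup tauM 1).
have [||H [l [tH cH]]] := @series_exist_surj (size s) Q tau tauM tauC tauS cQ.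
- by eexists; exact: eQ.
- by exists s => // x tx; have : [set x : Q | tau x = 1] x by []; rewrite ks.
have [l' cl'] : exists l', chain sigma (p @^-1` H) l'.
  apply: (chain_pullback pM pC pE pS cH) => F k csF Fk; exists [::].
  apply: (chain_nil (k := (k + k0)%N)); first exact: closed_stable_preimage csF.
  by move=> x /Fk /(congr1 val); rewrite (restrict_iter (H := JS)) /= -iterD.
by exists (p @^-1` H), l'; split=> //; exact: open_top_preimage pM pC pE tH.
Qed.

(** * Composition factors of abstract groups *)

(** Composition series of an abstract group, each simple quotient being presented by a map whose
    kernel is the next term. *)
Inductive factors (K : groupType) : set K -> seq finGroupType -> Prop :=
| factors_nil : factors [set 1] [::]
| factors_cons (H L : set K) (S : finGroupType) (phi : K -> S) l : is_subgroup H ->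
    (forall x y, H x -> H y -> phi (x * y) = phi x * phi y) ->
    (forall s, exists2 x, H x & phi x = s) ->
    (forall x, L x <-> H x /\ phi x = 1) ->
    simple [set: S]%SET -> factors L l -> factors H (S :: l).

Definition multiplicity (X : finGroupType) (l : seq finGroupType) : nat :=
  count (fun S : finGroupType => [set: X]%SET \isog [set: S]%SET) l.

Section SimpleImages.
Variables (K : groupType) (H : set K).
Hypothesis sH : is_subgroup H.

Section OneHom.
Variables (S : finGroupType) (phi : K -> S).
Hypothesis phiM : forall x y, H x -> H y -> phi (x * y) = phi x * phi y.
Hypothesis phiS : forall s, exists2 x, H x & phi x = s.

Lemma simple_nontrivial : simple [set: S]%SET -> ~ forall x, H x -> phi x = 1.
Proof.
case/simpleP => /eqP ntS _ phi1; apply: ntS; apply/setP => s; rewrite !inE.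
by apply/esym/eqP; have [x Hx <-] := phiS s; exact: phi1.
Qed.

(** The image [B] of [N] is normal in the simple group [S]. *)
Lemma simple_image (N : set K) : simple [set: S]%SET ->
  is_subgroup N -> N `<=` H -> normalises H N ->
  (forall x, N x -> phi x = 1) \/ forall s, exists2 x, N x & phi x = s.
Proof.
move=> /simpleP[_ simS] sN NH nN.
pose B := finset.finset (fun s => `[< exists2 x, N x & phi x = s >]).
have BP s : reflect (exists2 x, N x & phi x = s) (s \in B).
  by rewrite inE; exact: asboolP.
have gB : group_set B.
  apply/group_setP; split; first by apply/BP; exists 1;
    [exact: sub1|exact: (subhom1 sH phiM)].
  move=> _ _ /BP[x Nx <-] /BP[y Ny <-]; apply/BP; exists (x * y); first exact: subM.
  by rewrite phiM //; exact: NH.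
have nB : Group gB <| [set: S]%G.
  apply/normalP; split; first by apply/fintype.subsetP => s _; rewrite inE.
  move=> s _; apply/eqP; rewrite eqEcard cardJg leqnn andbT.
  apply/fintype.subsetP => _ /imsetP[_ /BP[x Nx <-] ->].
  have [y Hy <-] := phiS s; apply/BP; exists (x ^ y); first exact: nN.
  by rewrite (subhomJ sH phiM) //; exact: NH.
have [B1|BT] := simS _ nB; [left=> x Nx|right=> s].
  by apply/set1gP; rewrite -B1; apply/BP; exists x.
by apply/BP; rewrite -[B]/(gval (Group gB)) BT inE.
Qed.

End OneHom.

(** The isomorphism is [psi] after a section [g] of [phi]; equality of the kernels makes it
    independent of the section. *)
Lemma isog_of_kernel (S T : finGroupType) (phi : K -> S) (psi : K -> T) :
  (forall x y, H x -> H y -> phi (x * y) = phi x * phi y) ->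
  (forall s, exists2 x, H x & phi x = s) ->
  (forall x y, H x -> H y -> psi (x * y) = psi x * psi y) ->
  (forall t, exists2 x, H x & psi x = t) ->
  (forall x, H x -> phi x = 1 <-> psi x = 1) ->
  [set: S]%SET \isog [set: T]%SET.
Proof.
move=> phiM phiS psiM psiS ker.
have [g gP] : {g : S -> K & forall s, H (g s) /\ phi (g s) = s}.
  by apply: (@choice _ _ (fun s x => H x /\ phi x = s)) => s; have [x] := phiS s;
    exists x.
have gE s x : H x -> phi x = s -> psi (g s) = psi x.
  move=> Hx xs; have [Hg gs] := gP s.
  apply/esym/(@mulgI _ (psi (g s))^-1); rewrite mulVg -(subhomV sH psiM) // -psiM //;
    last exact: subV.
  apply/ker; first by apply: (subM sH) => //; exact: (subV sH).
  by apply: (subhom_ratio sH phiM); rewrite ?gs.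
have thM : {in [set: S]%SET &, {morph psi \o g : s t / s * t}}.
  move=> s t _ _ /=; have [[Hs gs] [Ht gt]] := (gP s, gP t).
  by rewrite -psiM //; apply: gE; [exact: subM|rewrite phiM // gs gt].
apply/isogP; exists (Morphism thM).
  apply/injmP => s t _ _ /= st; have [[Hs gs] [Ht gt]] := (gP s, gP t).
  rewrite -gs -gt; apply/(@mulgI _ (phi (g s))^-1);
    rewrite mulVg -(subhomV sH phiM) // -phiM //; last exact: subV.
  apply/esym/ker; first by apply: (subM sH) => //; exact: (subV sH).
  exact: (subhom_ratio sH psiM).
apply/setP => t; rewrite inE morphimEdom; apply/imsetP.
have [x Hx <-] := psiS t; exists (phi x); first by rewrite inE.
by rewrite /= (gE _ x).
Qed.

End SimpleImages.

Lemma factors_subgroup (K : groupType) (H : set K) l : factors H l -> is_subgroup H.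
Proof.
case=> // {H l}; split=> [//|x y -> ->|x ->]; first by rewrite mulg1.
by rewrite invg1.
Qed.

Lemma kernel_normal (K : groupType) (H L : set K) (S : finGroupType) (phi : K -> S) :
  is_subgroup H -> (forall x y, H x -> H y -> phi (x * y) = phi x * phi y) ->
  (forall x, L x <-> H x /\ phi x = 1) ->
  [/\ is_subgroup L, L `<=` H & normalises H L].
Proof.
move=> sH phiM LE; split.
- split=> [|x y /LE[Hx x1] /LE[Hy y1]|x /LE[Hx x1]]; apply/LE.
  + by split; [exact: sub1|exact: (subhom1 sH phiM)].
  + by split; [exact: subM|rewrite phiM // x1 y1 mulg1].
  + by split; [exact: subV|rewrite (subhomV sH phiM) // x1 invg1].
- by move=> x /LE[].
- move=> x y /LE[Hx x1] Hy; apply/LE; split;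
    last by rewrite (subhomJ sH phiM) // x1 conj1g.
  by rewrite conjgE; apply: subM => //; [exact: subV|exact: subM].
Qed.

(** Intersect the series with [N]: by [simple_image] each simple factor either survives whole or
    disappears. *)
Lemma factors_normal (K : groupType) (H N : set K) l : factors H l ->
  is_subgroup N -> N `<=` H -> normalises H N -> exists l', factors N l'.
Proof.
move=> fH; elim: fH N => {H l} [|H L S phi l sH phiM phiS LE simS _ IH] N sN NH nN.
  exists [::]; rewrite (_ : N = [set 1]); first exact: factors_nil.
  by apply/seteqP; split=> // _ ->; exact: sub1.
have [sL LH nL] := kernel_normal sH phiM LE.
have [l' fNL] : exists l', factors (N `&` L) l'.
  apply: IH; first exact: setI_subgroup.
    by move=> x [].
  by move=> x y [Nx Lx] Ly; split; [exact/nN/LH|apply: nL => //; exact: LH].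
have [N1|NS] := simple_image sH phiM phiS simS sN NH nN.
  exists l'; rewrite (_ : N = N `&` L) //.
  by apply/seteqP; split=> [x Nx|x []//]; split=> //; apply/LE; split;
    [exact: NH|exact: N1].
exists (S :: l'); apply: (factors_cons (phi := phi)) fNL => //.
- by move=> x y /NH Hx /NH Hy; exact: phiM.
- move=> x; split=> [[Nx /LE[_ x1]]//|[Nx x1]].
  by split=> //; apply/LE; split=> //; exact: NH.
Qed.

Lemma factors_inv (K : groupType) (H : set K) l : factors H l ->
  if l is T :: l' then exists (L : set K) (phi : K -> T),
    [/\ forall x y, H x -> H y -> phi (x * y) = phi x * phi y,
        forall s, exists2 x, H x & phi x = s,
        forall x, L x <-> H x /\ phi x = 1,
        simple [set: T]%SET & factors L l']
  else H = [set 1].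
Proof. by case=> // {}H L S phi {}l _ phiM phiS LE simS fL; exists L, phi. Qed.

Theorem jordan_hoelder (K : groupType) (H : set K) l l' :
  factors H l -> factors H l' ->
  size l = size l' /\ forall X, multiplicity X l = multiplicity X l'.
Proof.
have [n] := ubnP (size l); elim: n H l l' => // n IH H l l' ln fH fH'.
have sH := factors_subgroup fH.
have trivial_simple (T : finGroupType) (psi : K -> T) :
    (forall x y, H x -> H y -> psi (x * y) = psi x * psi y) ->
    (forall s, exists2 x, H x & psi x = s) -> simple [set: T]%SET -> H <> [set 1].
  move=> psiM psiS simT H1; apply: (simple_nontrivial psiS simT) => x.
  by rewrite H1 => ->; exact: (subhom1 sH psiM).
case: l l' ln fH fH' => [|S l] [|T l'] ln /factors_inv + /factors_inv //.
- by move=> H1 [B [psi [psiM psiS _ simT _]]]; case: (trivial_simple _ psi).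
- by move=> [A [phi [phiM phiS _ simS _]]] H1; case: (trivial_simple _ phi).
move=> [A [phi [phiM phiS AE simS fA]]] [B [psi [psiM psiS BE simT fB]]].
have [sA AH nA] := kernel_normal sH phiM AE.
have [sB BH nB] := kernel_normal sH psiM BE.
(* Excludes a proper inclusion between the kernels [A] and [B]: the larger one would be all of
   [H]. *)
have onto (C D : set K) (U : finGroupType) (th : K -> U) : is_subgroup C -> C `<=` H ->
    (forall x, D x <-> H x /\ th x = 1) -> D `<=` C ->
    (forall x y, H x -> H y -> th (x * y) = th x * th y) ->
    (forall t, exists2 x, C x & th x = t) -> H `<=` C.
  move=> sC CH DE DC thM thS x Hx; have [y Cy yx] := thS (th x).
  rewrite -(mulKVg y x); apply: subM => //; apply: DC; apply/DE.
  by split; [apply: subM => //; apply: subV => //;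
    exact: CH|apply: (subhom_ratio sH thM) => //; exact: CH].
have [phiB|phiB] := simple_image sH phiM phiS simS sB BH nB.
  have BA : B `<=` A by move=> x Bx; apply/AE; split; [exact: BH|exact: phiB].
  have [psiA|psiA] := simple_image sH psiM psiS simT sA AH nA; last first.
    have HA := onto A B T psi sA AH BE BA psiM psiA.
    by case: (simple_nontrivial phiS simS) => x /HA/AE[].
  have eAB : A = B.
    apply/seteqP; split=> // x Ax; apply/BE; split; [exact: AH|exact: psiA].
  rewrite -eAB in fB; have [sz mu] := IH A l l' ln fA fB.
  have iST : [set: S]%SET \isog [set: T]%SET.
    apply: (isog_of_kernel sH phiM phiS psiM psiS) => x Hx.
    split=> x1; first by have /psiA : A x by apply/AE.
    by have /phiB : B x by apply/BE.
  split=> [|X] /=; first by rewrite sz.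
  congr addn; last exact: mu.
  by rewrite (isog_transr _ (iST : [set: S]%G \isog [set: T]%G)).
have [psiA|psiA] := simple_image sH psiM psiS simT sA AH nA.
  have AB : A `<=` B by move=> x Ax; apply/BE; split; [exact: AH|exact: psiA].
  have HB := onto B A S phi sB BH AE AB phiM phiB.
  by case: (simple_nontrivial psiS simT) => x /HB/BE[].
have sAB := setI_subgroup sA sB.
have [l2 fAB] : exists l2, factors (A `&` B) l2.
  apply: (factors_normal fA sAB) => [x []//|x y [Ax Bx] Ay].
  by split; [apply: nA => //; exact: AH|apply: nB => //; exact: AH].
(* Now neither kernel contains the other, so [A] maps onto [T] and [B] onto [S], both with kernel
   the intersection. *)
have fA' : factors A (T :: l2).
  apply: (factors_cons (phi := psi)) fAB => // [x y /AH Hx /AH Hy|x].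
    exact: psiM.
  split=> [[Ax /BE[]]//|[Ax x1]]; split=> //; apply/BE; split=> //; exact: AH.
have fB' : factors B (S :: l2).
  apply: (factors_cons (phi := phi)) fAB => // [x y /BH Hx /BH Hy|x].
    exact: phiM.
  split=> [[/AE[] //]|[Bx x1]]; split=> //; apply/AE; split=> //; exact: BH.
have [szA muA] := IH A l (T :: l2) ln fA fA'.
(* By [szA] the list [S :: l2] is as long as [l], so induction applies to [B] too. *)
have [szB muB] := IH B (S :: l2) l' (eq_ind _ (fun m => (m < n)%N) ln _ szA) fB' fB.
split=> [|X] /=; first by rewrite szA -szB.
by have := (muA X, muB X) => -[/= -> <-]; rewrite addnCA.
Qed.

(** * Uniqueness *)

Section Uniqueness.
Variables (G : topGroupType) (sigma : G -> G).
Hypothesis sM : {morph sigma : x y / x * y}.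
Hypothesis sC : continuous sigma.
Hypothesis cG : compact [set: G].

Lemma chain_closed_stable H l : chain sigma H l -> closed_stable sigma H.
Proof. by case. Qed.

Lemma top_iter H n x : open_top sigma H -> H (iter n sigma x) -> H x.
Proof. by case=> _ _ _ _ iH; elim: n => [//|n IHn] /iH. Qed.

Lemma chain_sub_top H l T : chain sigma H l -> open_top sigma T -> H `<=` T.
Proof.
move=> cH oT; have [sT opT _ tT iT] := oT.
elim: cH => {H l} [H k _ Hk x Hx|H L S phi l csH [phiM phiC LE phiS] _ _ LT].
  by apply: (top_iter (n := k) oT); rewrite Hk //; exact: sub1.
have [sH clH tH] := csH.
pose F m := [set x | [/\ H x, ~ T x & forall i, (i < m)%N -> phi (iter i sigma x) = 1]].
(* Otherwise compactness gives an element of [H] outside [T] with all coordinates trivial, that is,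
   in [L], which lies in [T] by induction. *)
have [m mP] : exists m, forall x, H x -> (forall i, (i < m)%N ->
  phi (iter i sigma x) = 1) -> T x.
  apply: contrapT => /forallNP nP.
  have [||m|x xF] := nested_closed cG (F := F).
  - elim=> [|n IH].
      suff -> : F 0%N = H `&` ~` T by apply: closedI => //; rewrite closedC.
      by apply/seteqP; split=> [x []|x []].
    suff -> : F n.+1 = F n `&` [set x | H x /\ phi (iter n sigma x) \in pred1 (1 : S)].
      by apply: closedI => //; rewrite -openC; exact: (open_coordinate sC csH phiM phiC).
    apply/seteqP; split=> [x [Hx nTx x1]|x [[Hx nTx x1] [_ /eqP xn]]]; split=> //.
    + by split=> // i lin; apply: x1; exact: leqW.
    + by split=> //; apply/eqP; exact: x1.
    + by move=> i; rewrite ltnS leq_eqVlt => /orP[/eqP->//|]; exact: x1.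
  - by move=> n x [Hx nTx x1]; split=> // i lin; apply: x1; exact: leqW.
  - have /existsNP[x /not_implyP[Hx /not_implyP[x1 nTx]]] := nP m.
    by exists x.
  have [Hx nTx _] := xF 0%N; apply: nTx; apply: LT; apply/LE; split=> // n.
  by have [_ _] := xF n.+1; apply.
(* [u] lifts the first [m] coordinates of [h] followed by 1. Its m-th iterate lies in [L], so [u]
   lies in [T], and [mP] covers the ratio of [u] and [h]. *)
move=> h Hh; have [u Hu uh] :=
  phiS (fun i => if (i < m)%N then phi (iter i sigma h) else 1).
have Tu : T u.
  apply: (top_iter (n := m) oT); apply: LT; apply/LE; split=> [|n];
    first exact: stable_iter.
  by rewrite -iterD uh ltnNge leq_addl.
rewrite -(mulKVg u h); apply: subM => //; apply: mP.
  by apply: subM => //; exact: subV.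
move=> i im; rewrite endo_iterM // endo_iterV //.
by apply: (subhom_ratio sH phiM); rewrite ?uh ?im //; exact: stable_iter.
Qed.

(** * Normal stable subgroups with coordinates of bounded support *)

Section Truncation.
Variables (H L : set G) (S : finGroupType) (phi : G -> S).
Hypothesis csH : closed_stable sigma H.
Hypothesis phiM : forall x y, H x -> H y -> phi (x * y) = phi x * phi y.
Hypothesis LE : forall x, L x <-> H x /\ forall n, phi (iter n sigma x) = 1.
Hypothesis phiS : forall s : nat ->
  S, exists2 x, H x & forall n, phi (iter n sigma x) = s n.
Hypothesis simS : simple [set: S]%SET.

Let sH : is_subgroup H. Proof. by case: csH. Qed.
Let tH : stable sigma H. Proof. by case: csH. Qed.

Lemma coordM n x y : H x -> H y ->
  phi (iter n sigma (x * y)) = phi (iter n sigma x) * phi (iter n sigma y).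
Proof. by move=> Hx Hy; rewrite endo_iterM // phiM //; exact: stable_iter. Qed.

Lemma coord_onto n s : exists2 x, H x & phi (iter n sigma x) = s.
Proof. by have [x Hx xs] := phiS (fun=> s); exists x. Qed.

(* Shifting an element of maximal support puts all of S at position 0, by
   simplicity; less shifted, it gives all of S at every smaller position. *)
Lemma truncated_normal (B : set G) m : is_subgroup B -> B `<=` H -> L `<=` B ->
  normalises H B -> stable sigma B ->
  (forall x i, B x -> (m <= i)%N -> phi (iter i sigma x) = 1) ->
  exists j, forall x, H x -> B x <-> forall i, (j <= i)%N -> phi (iter i sigma x) = 1.
Proof.
move=> sB BH LB nB tB; elim: m => [|m IH] Bm.
  exists 0%N => x Hx; split=> [Bx i _|x1]; first exact: Bm.
  by apply: LB; apply/LE; split=> // n; exact: x1.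
have [B1|BS] := simple_image sH (coordM m) (coord_onto m) simS sB BH nB.
  apply: IH => x i Bx; rewrite leq_eqVlt => /orP[/eqP<-|]; first exact: B1.
  exact: Bm.
exists m.+1 => x Hx; split=> [Bx i|]; first exact: Bm.
suff truncB t y : (t <= m.+1)%N -> H y ->
    (forall i, (t <= i)%N -> phi (iter i sigma y) = 1) -> B y by exact: truncB.
elim: t y => [|t IHt] y tm Hy y1.
  by apply: LB; apply/LE; split=> // n; exact: y1.
have [b Bb bE] := BS (phi (iter t sigma y)).
have Bc : B (iter (m - t) sigma b) by exact: stable_iter.
have ce i : iter i sigma (iter (m - t) sigma b) = iter (i + (m - t))%N sigma b.
  by rewrite iterD.
rewrite -(mulKVg (iter (m - t) sigma b) y); apply: subM => //; apply: IHt => [||i].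
- exact: ltnW.
- by apply: subM => //; apply: subV => //; exact: BH.
rewrite endo_iterM // endo_iterV // => ti; apply: (subhom_ratio sH phiM).
- by apply: stable_iter => //; exact: BH.
- exact: stable_iter.
rewrite ce; move: ti; rewrite leq_eqVlt => /orP[/eqP<-|ti]; first by rewrite subnKC.
by rewrite y1 // Bm // -{1}(subnKC (_ : t <= m)%N) // ltn_add2r.
Qed.

End Truncation.

Variable N : set G.
Hypothesis eN : expansive_nbhd sigma N.

Definition image_kernel k (H : set G) : set G :=
  [set x | sigma x = 1] `&` (iter k sigma @` H).

Lemma image_kernel_subgroup k H : is_subgroup H -> is_subgroup (image_kernel k H).
Proof.
by move=> sH; apply: setI_subgroup; [exact: (killed_subgroup sM 1)|exact: image_subgroup].
Qed.

(** Each full shift contributes exactly one simple factor: the map [th] reads the last coordinate of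
    [h] not forced to be trivial when [h] is killed by the iterate of order [k.+1]. *)
Lemma chain_factors H l : chain sigma H l ->
  exists k0, forall k, (k0 <= k)%N -> factors (image_kernel k H) l.
Proof.
elim=> {H l} [H k0 csH Hk0|H L S phi l csH phiP simS cL [k1 IH]].
  exists k0 => k kk; suff -> : image_kernel k H = [set 1] by exact: factors_nil.
  have [sH _ _] := csH.
  apply/seteqP; split=> [_ [_ [y Hy <-]]|_ ->].
    by rewrite /= -(subnK kk) iterD Hk0 // endo_iter1.
  by split; [exact: endo1|exists 1; [exact: sub1|exact: endo_iter1]].
have csL := chain_closed_stable cL; have [LH nL] := shift_factor_normal sM csH phiP.
have [phiM _ LE phiS] := phiP.
have [k2 k2P] := image_stabilises sM sC cG eN csL.
have [[sH _ tH] [sL _ tL]] := (csH, csL).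
exists (maxn k1 k2) => k; rewrite geq_max => /andP[k1k k2k].
(* Modulo [L] this is a normal stable subgroup of the shift with coordinates trivial from [k] on, so
   it consists of the sequences trivial from some [j] on. *)
pose B := [set h | H h /\ exists2 y, L y & iter k sigma h = iter k sigma y].
have sB : is_subgroup B.
  split=> [|x y [Hx [a La xa]] [Hy [b Lb yb]]|x [Hx [a La xa]]].
  - by split; [exact: sub1|exists 1 => //; exact: sub1].
  - split; first exact: subM.
    by exists (a * b); [exact: subM|rewrite !endo_iterM // xa yb].
  - split; first exact: subV.
    by exists a^-1; [exact: subV|rewrite !endo_iterV // xa].
have nB : normalises H B.
  move=> x y [Hx [a La xa]] Hy; split.
    by rewrite conjgE; apply: subM => //; [exact: subV|exact: subM].
  by exists (a ^ y); [exact: nL|rewrite !endo_iterJ // xa].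
have tB : stable sigma B.
  move=> x [Hx [a La xa]]; split; first exact: tH.
  by exists (sigma a); [exact: tL|rewrite -!iterSr !iterS xa].
have LB : L `<=` B by move=> x Lx; split; [exact: LH|exists x].
have BH : B `<=` H by move=> x [].
have Bk x i : B x -> (k <= i)%N -> phi (iter i sigma x) = 1.
  move=> [Hx [a La xa]] ki; rewrite -(subnK ki) iterD xa -iterD.
  by have /LE[] := La.
have [j jP] := truncated_normal csH phiM LE phiS simS sB BH LB nB tB Bk.
(* [sigma h] lies in [B], so the coordinates of [h] vanish strictly above [j]. *)
have BsE h : H h -> iter k.+1 sigma h = 1 -> forall i, (j < i)%N ->
  phi (iter i sigma h) = 1.
  move=> Hh h1 [//|i] ji; rewrite iterSr; apply: (jP _ (tH h Hh)).1 => //.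
  by split; [exact: tH|exists 1; [exact: sub1|rewrite -iterSr h1 endo_iter1]].
have coord_eq h h' : H h -> H h' -> iter k sigma h = iter k sigma h' ->
    phi (iter j sigma h) = phi (iter j sigma h').
  move=> Hh Hh' hh'; apply/(@mulgI _ (phi (iter j sigma h))^-1).
  have Hhj := stable_iter j tH Hh; have Hhj' := stable_iter j tH Hh'.
  rewrite mulVg -(subhomV sH phiM) // -phiM //; last exact: subV.
  rewrite -endo_iterV // -endo_iterM //; apply/esym.
  have Hhh : H (h^-1 * h') by apply: subM => //; exact: subV.
  apply: (jP _ Hhh).1 => //; split=> //; exists 1; first exact: sub1.
  by rewrite endo_iterM // endo_iterV // hh' mulVg endo_iter1.
(* By [coord_eq] the choice of the k-th preimage [h] is immaterial; the default 1 occurs only off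
   the image of [H]. *)
pose th x := phi (iter j sigma (xget 1 [set h | H h /\ iter k sigma h = x])).
have thE h : H h -> th (iter k sigma h) = phi (iter j sigma h).
  move=> Hh; rewrite /th; case: xgetP => [h' _ [Hh' hh']|/(_ h)]; first exact: coord_eq.
  by case.
apply: (factors_cons (phi := th) (L := image_kernel k L)) => //.
- exact: image_kernel_subgroup.
- move=> _ _ [_ [x Hx <-]] [_ [y Hy <-]]; rewrite -endo_iterM // !thE //;
    last exact: subM.
  by rewrite endo_iterM // phiM //; exact: stable_iter.
(* Place [s] at position [j] only. Then [sigma h] lies in [B], and stabilisation of the images of
   [L] gives [b] in [L] such that h b^-1 is killed by the iterate of order [k.+1]; dividing by [b]
   leaves the coordinates unchanged. *)
- move=> s; have [h Hh hs] := phiS (fun i => if i == j then s else 1).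
  have [_ [a La ha]] : B (sigma h).
    apply/(jP _ (tH h Hh)) => i ji; rewrite -iterSr hs ifN_eqC //.
    by rewrite neq_ltn ltnS ji.
  have [b Lb ab] := k2P k a k2k La.
  have Hb := LH b Lb; have HbV := subV sH Hb.
  exists (iter k sigma (h * b^-1)).
    split; last by exists (h * b^-1) => //; exact: subM.
    by rewrite /= -iterS endo_iterM // endo_iterV // ab iterSr ha mulgV.
  rewrite thE; last exact: subM.
  have /LE[_ b1] := Lb.
  rewrite endo_iterM // phiM ?hs ?eqxx; [|exact: stable_iter|exact: stable_iter].
  by have /LE[_ ->] := subV sL Lb; rewrite mulg1.
- move=> x; split=> [[x1 [y Ly yx]]|[[x1 [h Hh hx]] th1]].
    have Hy := LH y Ly; split; first by split=> //; exists y.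
    by rewrite -yx thE //; have /LE[] := Ly.
  split=> //; rewrite -hx.
  (* The coordinate at [j] is trivial by [th1] and those above by [BsE]. *)
  suff [_ [y Ly ->]] : B h by exists y.
  apply/(jP _ Hh) => i; rewrite leq_eqVlt => /orP[/eqP<-|]; first by rewrite -thE // hx.
  by apply: BsE; rewrite // iterS hx.
- exact: IH.
Qed.

Lemma chain_unique H l l' : chain sigma H l -> chain sigma H l' ->
  size l = size l' /\ forall X, multiplicity X l = multiplicity X l'.
Proof.
move=> /chain_factors[k kP] /chain_factors[k' k'P].
by apply: jordan_hoelder (kP _ (leq_maxl k k')) (k'P _ (leq_maxr k k')).
Qed.

End Uniqueness.

(** * Internal and quotient descriptions of the series *)

Section FullShiftDynamics.
Variable S : finGroupType.

Lemma full_shift_hausdorff : hausdorff_space (full_shift S).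
Proof.
move=> f g fg; apply/funext => n.
by have [h [/= <- <-]] := fg _ _ (full_shift_nbhs f n) (full_shift_nbhs g n).
Qed.

Lemma shift_iter n m (f : full_shift S) : iter n (@shift S) f m = f (m + n)%N.
Proof. by elim: n m => [|n IH] m /=; rewrite ?addn0 // /shift IH addSnnS. Qed.

End FullShiftDynamics.

Section ShiftQuotient.
Variables (G : topGroupType) (sigma : G -> G) (H L : stable_subgroup sigma).
Variables (nLH : normalised_by H L) (S : finGroupType).
Hypothesis sM : {morph sigma : x y / x * y}.
Hypothesis sC : continuous sigma.
Local Notation R := (restrict_endo H).
Local Notation N := (relative_normal_subgroup nLH).
Local Notation Q := (Defs.quotient_group N).
Local Notation tau := (@quotient_endo (set_type H) N R).
Local Open Scope quotient_scope.
Local Notation pi := (\pi_(Defs.quotient_group N)).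

Let tN : stable R (N : set (set_type H)).
Proof. by move=> x Lx; apply/set_mem/stable_subgroup_stable/mem_set. Qed.

Lemma shift_factor_of_iso : (L : set G) `<=` H ->
  isomorphic_with_endo (tau : Q -> Q) (@shift S) ->
  exists phi : G -> S, shift_factor sigma H L phi.
Proof.
move=> LH [f [[fM fC [g [fK gK gC]]] fs]].
(* The zeroth coordinate of [f], set to 1 off [H]; equivariance recovers the others. *)
pose phi x : S := oapp (fun u : set_type H => (f (pi u) : full_shift S) 0%N : S) 1
  (insub x).
have phiE (u : set_type H) : phi (val u) = f (pi u) 0%N by rewrite /phi valK.
have phi_iter (u : set_type H) n : phi (iter n sigma (val u)) = f (pi u) n.
  rewrite -restrict_iter phiE -quotient_endo_iter //; last exact: restrict_morph.
  by rewrite (equivariant_iter fs) shift_iter.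
have f1 : f 1 = 1 by exact: hom1.
have HE x : (H : set G) x -> exists u : set_type H, val u = x.
  by move=> Hx; exists (SigSub (mem_set Hx)).
exists phi; split.
- move=> _ _ /HE[u <-] /HE[v <-]; rewrite (phiE u) (phiE v).
  have -> : val u * val v = val (u * v) by [].
  by rewrite phiE quotient_piM fM.
- have fpC : continuous (f \o pi).
    by move=> u; apply: continuous_comp; [exact: quotient_pi_continuous|exact: fC].
  have := fpC 1 _ (full_shift_nbhs _ 0%N).
  rewrite nbhs_filterE /= => -[_ [[V oV <-] V1 VF]].
  exists V; first by split.
  move=> x Vx /HE[u ux]; move: Vx; rewrite -ux phiE => /VF /= ->.
  by rewrite (_ : pi 1 = 1) ?f1 //; exact/(quotient_pi_eq1 N)/sub1/subgroup_is_subgroup.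
- move=> x.
  have key (u : set_type H) : (L : set G) (val u) <-> forall n,
    phi (iter n sigma (val u)) = 1.
    split=> [Lu n|u1].
      by rewrite phi_iter (_ : pi u = 1) ?f1 //; exact/(quotient_pi_eq1 N).
    apply/(quotient_pi_eq1 N); rewrite -[pi u]fK -[1]fK f1; congr g.
    by apply/funext => n; rewrite -phi_iter u1.
  split=> [Lx|[/HE[u <-] /key//]]; split; first exact: LH.
  by have [u ux] := HE x (LH x Lx); rewrite -ux; apply/key; rewrite ux.
- move=> s; exists (val (repr (g s))); first exact: (set_mem (valP _)).
  by move=> n; rewrite phi_iter reprK gK.
Qed.

Lemma iso_of_shift_factor (phi : G -> S) : compact [set: G] ->
  shift_factor sigma H L phi -> isomorphic_with_endo (tau : Q -> Q) (@shift S).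
Proof.
move=> cG [phiM [V [oV V1] phiV] LE phiS].
have [sH clH tH] := stable_subgroup_closed_stable H.
have valH (u : set_type H) : (H : set G) (val u) by exact: (set_mem (valP u)).
have iterH n (u : set_type H) : (H : set G) (iter n sigma (val u)).
  exact: stable_iter.
pose F (u : set_type H) : full_shift S := fun n => phi (iter n sigma (val u)).
have FM : {morph F : u v / u * v}.
  move=> u v; apply/funext => n.
  by rewrite /F [val _]/(val u * val v) endo_iterM // phiM.
have FN u v : (N : set _) (u^-1 * v) <-> F u = F v.
  have -> : (N : set (set_type H)) (u^-1 * v) <-> (L : set G) ((val u)^-1 * val v) by [].
  split=> [/LE[_ e1]|Fuv].
    apply/funext => n; apply/(@mulgI _ (phi (iter n sigma (val u)))^-1).
    rewrite mulVg -(subhomV sH phiM) // -phiM //; last exact: subV.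
    by rewrite -endo_iterV // -endo_iterM // e1.
  apply/LE; split=> [|n]; first by apply: (subM sH) => //; exact: (subV sH).
  rewrite endo_iterM // endo_iterV //; apply: (subhom_ratio sH phiM) => //.
  by have := congr1 (fun s : full_shift S => s n) Fuv.
have FC : continuous F.
  apply: full_shift_continuous => t n.
  pose W := (fun x => (iter n sigma (val t))^-1 * iter n sigma x) @^-1` V.
  have : nbhs t ((set_val : set_type H -> G) @^-1` W).
    apply: set_val_continuous; apply: open_nbhs_nbhs; split; last by rewrite /W /= mulVg.
    apply: open_preimage oV => y.
    apply: (@continuous_comp _ _ _ (iter n sigma) (fun z => (iter n sigma (val t))^-1 *
      z)).
      exact: iter_continuous.
    exact: mulgl_continuous.
  apply: filterS => u /= /phiV e; apply/esym/(@mulgI _ (phi (iter n sigma (val t)))^-1).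
  rewrite mulVg -(subhomV sH phiM) // -phiM //; last exact: subV.
  apply/esym/e; apply: (subM sH); [apply: (subV sH)|]; exact: iterH.
pose f (q : Q) : full_shift S := F (repr q).
have fE u : f (pi u) = F u.
  by rewrite /f; apply/FN/(quotient_pi_eq N); rewrite reprK.
have fM : {morph f : x y / x * y}.
  move=> x y; have [[u <-] [v <-]] := (quotient_pi_surj x, quotient_pi_surj y).
  by rewrite -quotient_piM !fE FM.
have fC : continuous f.
  apply/quotient_continuous; rewrite (_ : _ \o _ = F) //.
  by apply/funext => u /=; exact: fE.
have fI : injective f.
  move=> x y; have [[u <-] [v <-]] := (quotient_pi_surj x, quotient_pi_surj y).
  by rewrite !fE => /FN /(quotient_pi_eq N).
have [g gP] : {g : full_shift S -> Q & forall s, f (g s) = s}.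
  apply: (@choice _ _ (fun s q => f q = s)) => s; have [x Hx xs] := phiS s.
  by exists (pi (SigSub (mem_set Hx))); rewrite fE; apply/funext.
have gK : cancel f g by move=> q; apply: fI; rewrite gP.
exists f; split.
  split=> //; exists g; split=> //.
  (* A continuous bijection from a compact space to a Hausdorff space is closed. *)
  apply/continuous_closedP => A clA.
  have -> : g @^-1` A = f @` A.
    apply/seteqP; split=> [s /= As|_ [q Aq <-]]; first by exists (g s).
    by rewrite /= gK.
  apply: compact_closed; first exact: full_shift_hausdorff.
  apply: continuous_compact; first exact: continuous_subspaceT.
  by apply: (subclosed_compact clA (quotient_compact (N := N) (restrict_compact (H :=
    H) cG))).
move=> q; have [u <-] := quotient_pi_surj q.
rewrite quotient_endo_pi //; last exact: restrict_morph.
by rewrite !fE; apply/funext => n; rewrite /shift /F iterSr.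
Qed.

End ShiftQuotient.

Section TopQuotient.
Variables (G : topGroupType) (sigma : G -> G) (N : normal_subgroup G).
Hypothesis sM : {morph sigma : x y / x * y}.
Hypothesis sC : continuous sigma.
Hypothesis tN : stable sigma (N : set G).
Local Notation Q := (Defs.quotient_group N).
Local Notation tau := (@quotient_endo G N sigma).
Local Open Scope quotient_scope.
Local Notation pi := (\pi_(Defs.quotient_group N)).

Lemma open_top_of_quotient : closed (N : set G) -> finite_set [set: Q] ->
  topgroup_isomorphism (tau : Q -> Q) -> open_top sigma (N : set G).
Proof.
move=> clN /finite_seqP[qs qsE] [_ _ [g [tauK _ _]]]; split=> //.
- exact: subgroup_is_subgroup.
(* [N] is the complement of the finitely many other cosets, which are closed; for q = 1 the
   condition is vacuous. *)
- rewrite (_ : (N : set G) = \bigcap_(q in [set` qs]) [set x | pi x = q -> q = 1]).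
    apply: open_bigcap_seq => q; have [->|q1] := pselect (q = 1).
      by rewrite (_ : [set x | _] = setT) ?seteqP //; exact: openT.
    have [y yq] := quotient_pi_surj q.
    rewrite (_ : [set x | _] = ~` ((fun x => y^-1 * x) @^-1` (N : set G))).
      rewrite openC; apply: closed_preimage clN; exact: mulgl_continuous.
    rewrite -yq; apply/seteqP; split=> [x nx /quotient_pi_eq e|x nx xy].
      by apply: q1; rewrite -yq; exact: nx.
    by case: nx; apply/quotient_pi_eq.
  apply/seteqP; split=> [x Nx q _ <-|x xE]; first exact/quotient_pi_eq1.
  by apply/(quotient_pi_eq1 N)/(xE (pi x)) => //; rewrite -qsE.
- by move=> x y Nx _; apply/set_mem/normal_subgroup_conjg/mem_set.
- move=> x Nsx; apply/(quotient_pi_eq1 N)/(can_inj tauK).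
  have -> : (1 : Q) = pi 1 by [].
  rewrite !quotient_endo_pi // (endo1 sM); exact/(quotient_pi_eq1 N).
Qed.

Lemma quotient_of_open_top : compact [set: G] -> open_top sigma (N : set G) ->
  finite_set [set: Q] /\ topgroup_isomorphism (tau : Q -> Q).
Proof.
move=> cG [sN oN _ _ iN].
have openQ (A : set Q) : open A.
  rewrite /open /= /quotient_open openE => x Ax; rewrite /interior nbhsE.
  exists ((fun y => x^-1 * y) @^-1` (N : set G)).
    split; last by rewrite /= mulVg; exact: sub1.
    by apply: open_preimage oN; exact: mulgl_continuous.
  by move=> y /quotient_pi_eq xy; move: Ax; rewrite /= xy.
split.
  have [xs xsP] := finite_cosets cG oN (sub1 sN).
  apply: (@sub_finite_set _ _ (pi @` [set` xs])); last exact/finite_image/finite_seq.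
  move=> q _; have [x <-] := quotient_pi_surj q; have [y yxs /quotient_pi_eq yx] := xsP x.
  by exists y.
have tauI : injective tau.
  move=> a b; have [[x <-] [y <-]] := (quotient_pi_surj a, quotient_pi_surj b).
  rewrite !quotient_endo_pi // => /quotient_pi_eq; rewrite -(endoV sM) -sM => /iN.
  by move/quotient_pi_eq.
(* The images of the iterates of [tau] stabilise, and injectivity cancels the iterate of order
   [n0]. *)
have tauS b : exists a, tau a = b.
  have [||n0 n0P] := stabilise cG oN sN
    (P := fun n => [set x | exists y, pi x = pi (iter n sigma y)]).
  - move=> n x u [y xy] Nu; exists y; rewrite -xy; apply/esym/quotient_pi_eq.
    by rewrite mulKg.
  - by move=> n x [y xy]; exists (sigma y); rewrite -iterSr.
  have [x <-] := quotient_pi_surj b.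
  have [y xy] := n0P n0.+1 _ (leqnSn _) (ex_intro _ x erefl : _ (iter n0 sigma x)).
  exists (pi y); rewrite quotient_endo_pi //.
  move: xy; rewrite iterSr -!(quotient_endo_iter sM tN).
  elim: n0 {n0P} => //= n IH /tauI; exact: IH.
have [g gP] : {g : Q -> Q & forall b, tau (g b) = b}.
  exact: (@choice _ _ (fun b a => tau a = b)).
split; first exact: quotient_endo_morph.
  exact: quotient_endo_continuous.
exists g; split=> // [a|]; first by apply: tauI; rewrite gP.
by apply/continuousP => A _; exact: openQ.
Qed.

End TopQuotient.

(** * Passage between series and chains *)

Section Series.
Variables (G : topGroupType) (sigma : G -> G).
Hypothesis sM : {morph sigma : x y / x * y}.
Hypothesis sC : continuous sigma.

Lemma chain_of_series n Gs Ss : @shift_series G sigma n Gs Ss ->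
  chain sigma (Gs 1%N) [seq Ss i | i <- iota 1 n.-1].
Proof.
case=> n1 sub nrm _ sim sh _ [_ [k _ Gk]].
suff main d i : (i + d = n)%N -> (1 <= i)%N ->
  chain sigma (Gs i) [seq Ss j | j <- iota i d].
  by apply: main; rewrite // add1n prednK.
elim: d i => [|d IH] i idn i1.
  have -> : i = n by rewrite -idn addn0.
  apply: (chain_nil (k := k)); first exact: stable_subgroup_closed_stable.
  move=> x Gx; have := congr1 val (Gk (SigSub (mem_set Gx))).
  by rewrite restrict_iter.
have hi : (1 <= i < n)%N by rewrite i1 -idn addnS ltnS leq_addr.
have [phi phiP] := shift_factor_of_iso sM (sub i hi) (sh i hi).
apply: (chain_cons (phi := phi)) phiP (sim i hi) _;
  first exact: stable_subgroup_closed_stable.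
by apply: IH; rewrite // addSnnS.
Qed.

Lemma open_top_of_series n Gs Ss : @shift_series G sigma n Gs Ss ->
  open_top sigma (Gs 1%N).
Proof.
case=> _ _ _ nT _ _ [fT iT] _.
by apply: (open_top_of_quotient sM _ _ fT iT) => [x /= Gx|];
  [apply/set_mem/stable_subgroup_stable/mem_set|exact: stable_subgroup_closed].
Qed.

Hypothesis cG : compact [set: G].

Definition stable_subgroup_of H (csH : closed_stable sigma H) : stable_subgroup sigma :=
  let: And3 sH clH tH := csH in
  @StableSubgroup G sigma (Subgroup (is_subgroup_closed sH)) clH
    (fun x Hx => mem_set (tH x (set_mem Hx))).

Lemma stable_subgroup_ofE H (csH : closed_stable sigma H) :
  (stable_subgroup_of csH : set G) = H.
Proof. by case: csH. Qed.

Lemma normalised_by_of (H L : stable_subgroup sigma) :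
  normalises (H : set G) L -> normalised_by H L.
Proof. by move=> nHL x y /set_mem Lx /set_mem Hy; apply/mem_set; exact: nHL. Qed.

Lemma sequence_of_chain H l : chain sigma H l ->
  exists (Gs : nat -> stable_subgroup sigma) (Ss : nat -> finGroupType) k,
    [/\ (Gs 0%N : set G) = H,
        forall i, (i < size l)%N -> simple [set: Ss i]%SET,
        forall i, (i < size l)%N ->
          exists phi : G -> Ss i, shift_factor sigma (Gs i) (Gs i.+1) phi
      & forall x, (Gs (size l) : set G) x -> iter k sigma x = 1].
Proof.
elim=> {H l} [H k csH Hk|H L S phi l csH phiP simS _ [Gs [Ss [k [G0 sim sh bot]]]]].
  (* [{perm 'I_0}] is a placeholder for simple groups beyond the end of the list. *)
  exists (fun=> stable_subgroup_of csH), (fun=> {perm 'I_0}), k.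
  by split=> // [|x]; rewrite stable_subgroup_ofE //; exact: Hk.
exists (fun i => if i is j.+1 then Gs j else stable_subgroup_of csH).
exists (fun i => if i is j.+1 then Ss j else S), k; split=> //.
- exact: stable_subgroup_ofE.
- by case=> // i; exact: sim.
- case=> [_|i]; last exact: sh.
  by exists phi; rewrite stable_subgroup_ofE G0.
Qed.

Lemma series_of_chain (U H : set G) l : expansive_nbhd sigma U ->
  open_top sigma H -> chain sigma H l ->
  exists n Gs Ss, @shift_series G sigma n Gs Ss.
Proof.
move=> eU oH /sequence_of_chain[Gs [Ss [k [G0 sim sh bot]]]].
have csG i : closed_stable sigma (Gs i : set G) by exact: stable_subgroup_closed_stable.
(* Chains are indexed from 0 and series from 1, and [size l] factors need one more subgroup. *)
pose Hs i := Gs i.-1.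
have prd i : (1 <= i < (size l).+1)%N -> (i.-1 < size l)%N by case: i.
have sh' i : (1 <= i < (size l).+1)%N ->
    exists phi : G -> Ss i.-1, shift_factor sigma (Hs i) (Hs i.+1) phi.
  by case: i => // i /prd; exact: sh.
have nrm i : (1 <= i < (size l).+1)%N -> normalised_by (Hs i) (Hs i.+1).
  move=> /sh'[phi phiP]; apply: normalised_by_of.
  by have [] := shift_factor_normal sM (csG _) phiP.
have nT x y : x \in (Hs 1%N : set G) -> x ^ y \in (Hs 1%N : set G).
  by move=> /set_mem; rewrite /Hs /= G0 => Hx; apply/mem_set; case: oH => _ _ nH _ _;
    exact: nH.
exists (size l).+1, Hs, (fun i => Ss i.-1).
apply: (@ShiftSeries _ _ _ _ _ _ _ nrm nT) => //.
- by move=> i /sh'[phi phiP]; have [] := shift_factor_normal sM (csG _) phiP.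
- by move=> i /prd; exact: sim.
- by move=> i hi; have [phi phiP] := sh' i hi; exact: iso_of_shift_factor phiP.
- apply: quotient_of_open_top => //=.
    by move=> x; case: (csG 0%N) => _ _; exact.
  by rewrite G0.
- split.
    by apply: (killed_finite sM sC cG eU (k := k)) => //; case: (csG (size l)).
  (* [k] may be 0, while the exponent must be positive. *)
  exists k.+1 => // x; apply: val_inj.
  by rewrite restrict_iter iterS bot ?(endo1 sM) //; exact: (set_mem (valP x)).
Qed.

End Series.

(** Encode an isomorphism class by the position [e] of its first member in the joint list. Equal
    multiplicities make the two tuples of codes permutations of each other. *)
Lemma isog_permutation n (S T : nat -> finGroupType) :
  (forall X, multiplicity X [seq S i | i <- iota 1 n] =
             multiplicity X [seq T i | i <- iota 1 n]) ->
  exists p : {perm 'I_n}, forall i : 'I_n, [set: S i.+1]%SET \isog [set: T (p i).+1]%SET.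
Proof.
move=> ST; pose l := [seq S i | i <- iota 1 n] ++ [seq T i | i <- iota 1 n].
pose e (X : finGroupType) :=
  find (fun Y : finGroupType => [set: X]%SET \isog [set: Y]%SET) l.
pose listed (X : finGroupType) :=
  has (fun Y : finGroupType => [set: X]%SET \isog [set: Y]%SET) l.
(* Unlisted groups all receive the code [size l], whence the restriction on [X]. *)
have eE (X Y : finGroupType) : listed X ->
  (e X == e Y) = ([set: X]%SET \isog [set: Y]%SET).
  move=> lX; apply/eqP/idP => [eXY|XY].
    have lY : listed Y by rewrite /listed has_find -/(e Y) -eXY -has_find.
    pose Z (i : nat) : finGroupType := nth ({perm 'I_0} : finGroupType) l i.
    have XZ : [set: X]%SET \isog [set: Z (e X)]%SET by exact: nth_find lX.
    have YZ : [set: Y]%SET \isog [set: Z (e X)]%SET by rewrite eXY; exact: nth_find lY.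
    by apply: isog_trans XZ _; rewrite isog_sym.
  by apply: eq_find => Z; exact: (isog_transl _ (XY : [set: X]%G \isog [set: Y]%G)).
have listedS i : i \in iota 1 n -> listed (S i) /\ listed (T i).
  move=> iin; rewrite /listed !has_cat !has_map; split; apply/orP; [left|right];
    by apply/hasP; exists i => //=; exact: isog_refl.
pose tS := [tuple e (S i.+1) | i < n]; pose tT := [tuple e (T i.+1) | i < n].
have mapE (R : nat -> finGroupType) : [tuple e (R i.+1) | i < n] = [seq e (R i) |
   i <- iota 1 n] :> seq nat.
  by rewrite /= -[1%N]/(1 + 0)%N iotaDl -map_comp -val_enum_ord -map_comp.
have : perm_eq tS tT.
  rewrite /tS /tT !mapE; apply/allP => x; rewrite mem_cat => xin; apply/eqP.
  have [X lX ->] : exists2 X, listed X & x = e X.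
    by case/orP: xin => /mapP[i /listedS[lS lT] ->]; [exists (S i)|exists (T i)].
  rewrite /= !count_map; have := ST X; rewrite /multiplicity !count_map => STX.
  have cE (R : nat -> finGroupType) : count (preim (fun i => e (R i)) (pred1 (e X)))
    (iota 1 n)
      = count (preim R (fun Y : finGroupType => [set: X]%SET \isog [set: Y]%SET)) (iota
        1 n).
    by apply: eq_count => i /=; rewrite eq_sym eE.
  by rewrite !cE.
case/tuple_permP => p /val_inj pE; exists p => i.
have [lS _] : listed (S i.+1) /\ listed (T i.+1).
  by apply: listedS; rewrite mem_iota add1n !ltnS leq0n /=.
rewrite -eE //; apply/eqP.
by have := congr1 (fun t => tnth t i) pE; rewrite /tS /tT !tnth_mktuple.
Qed.

Theorem theoremA (G : topGroupType) (sigma : G -> G) :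
  profinite G -> endomorphism sigma -> expansive sigma ->
  (exists (n : nat) (Gs : nat -> stable_subgroup sigma)
          (Ss : nat -> finGroupType), shift_series n Gs Ss) /\
  (forall (n m : nat) (Gs Hs : nat -> stable_subgroup sigma)
          (Ss Ts : nat -> finGroupType),
     shift_series n Gs Ss -> shift_series m Hs Ts ->
     [/\ m = n,
         (Hs 1%N : set G) = (Gs 1%N : set G)
       & exists pi : {perm 'I_n.-1}, forall i : 'I_n.-1,
           [set: Ss i.+1]%SET \isog [set: Ts (pi i).+1]%SET]).
Proof.
move=> [cG hG _] eS [U [oU U1]]; have [sM sC] := eS.
have eU : expansive_nbhd sigma (U : set G).
  split=> // [|x Ux]; first exact: subgroup_is_subgroup.
  suff : (\bigcap_n (iter n sigma @^-1` (U : set G))) x by rewrite U1.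
  by move=> n _; exact: Ux.
split.
  have [H [l [oH cH]]] := series_exist eS cG hG (ex_intro _ _ eU).
  exact: (series_of_chain sM sC cG eU oH cH).
move=> n m Gs Hs Ss Ts sG sH.
have [oG oH] := (open_top_of_series sM sG, open_top_of_series sM sH).
have [chG chH] := (chain_of_series sM sG, chain_of_series sM sH).
have eGH : (Hs 1%N : set G) = Gs 1%N.
  by apply/seteqP; split;
    [exact: (chain_sub_top sM sC cG chH oG)|exact: (chain_sub_top sM sC cG chG oH)].
rewrite eGH in chH; have [sz mu] := chain_unique sM sC cG eU chG chH.
have emn : m = n.
  move: sz; rewrite !size_map !size_iota => nm.
  have n1 := series_length sG; have m1 := series_length sH.
  by rewrite -(prednK n1) nm (prednK m1).
by split=> //; apply: isog_permutation => X; rewrite mu emn.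
Qed.
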